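(* Let $S$ be a family of concentric cylinders $\mathcal{Y}(r)$ or a family of concentric ellipsoids $\mathcal{E}(r)$, let $G=(V,E)$ be a finite simple graph with $V=\{v_1,\dots,v_n\}$, and let $(G,p)$ be an infinitesimally rigid framework on $S$. Let $\mu=6$ for cylinders and $\mu=3$ for ellipsoids. Suppose $(\omega,\lambda)$ is an equilibrium stress for $(G,p)$ on $S$ with $\operatorname{rank}\Omega_S(\omega,\lambda)=3n-\mu$. Let $G'=(V',E')$ be a $1$-extension of $G$ and let $q:V'\to\mathbb{R}^3$ be such that $q$ is generic as a point of $\mathbb{R}^{3(n+1)}$. Then $(G',q)$ is infinitesimally rigid on $S^q$ and has an equilibrium stress $(\omega',\lambda')$ on $S^q$ with $\operatorname{rank}\Omega_{S^q}(\omega',\lambda')=3(n+1)-\mu$.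
   Context: Fix $\alpha,\beta\in\mathbb{Q}$ with $1<\alpha<\beta$. A point of $\mathbb{R}^{N}$ is generic if its coordinates are algebraically independent over $\mathbb{Q}$. Surfaces. For a vector $r=(r_1,\dots,r_n)$ of positive reals, $\mathcal{Y}(r)=\bigcup_i\mathcal{Y}_i$ with $\mathcal{Y}_i=\{x^2+y^2=r_i\}\subset\mathbb{R}^3$, and $\mathcal{E}(r)=\bigcup_i\mathcal{E}_i$ with $\mathcal{E}_i=\{x^2+\alpha y^2+\beta z^2=r_i\}\subset\mathbb{R}^3$. Write $S=\bigcup_i S_i$ for either. Let $\ell=2$ for cylinders and $\ell=0$ for ellipsoids. A framework $(G,p)$ on $S$ is a map $p:V\to\mathbb{R}^3$ with $p(v_i)\in S_i$ for all $i$. For a map $q$ from a vertex set to $\mathbb{R}^3$, $S^q$ (the surface induced by $q$) is the unique family of the same type as $S$ (cylinders, or ellipsoids with the same $\alpha,\beta$), with one surface per vertex, such that each vertex lies on its own surface; i.e. the parameter of a vertex $v$ with $q(v)=(x,y,z)$ is $x^2+y^2$ (resp. $x^2+\alpha y^2+\beta z^2$). Rigidity matrix. Let $s_i(x,y,z)=(x,y,0)$ for cylinders and $s_i(x,y,z)=(x,\alpha y,\beta z)$ for ellipsoids. $R_S(G,p)$ is the $(|E|+n)\times 3n$ matrix with a triple of columns per vertex: the row of an edge $v_iv_j$ has $p(v_i)-p(v_j)$ in the columns of $v_i$, $p(v_j)-p(v_i)$ in the columns of $v_j$, and $0$ elsewhere; the row of a vertex $v_i$ has $s_i(p(v_i))$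 in the columns of $v_i$ and $0$ elsewhere. $(G,p)$ is infinitesimally rigid on $S$ if $\operatorname{rank}R_S(G,p)=3n-\ell$ (with $n$ the number of vertices of the graph). Stresses. A stress is a pair $(\omega,\lambda)$, $\omega:E\to\mathbb{R}$, $\lambda:V\to\mathbb{R}$; it is an equilibrium stress for $(G,p)$ on $S$ if $(\omega,\lambda)R_S(G,p)=0$. Put $\omega_{ij}=\omega(v_iv_j)$ if $v_iv_j\in E$ and $0$ otherwise. $\Omega$ is the $n\times n$ symmetric matrix with off-diagonal entries $-\omega_{ij}$ and diagonal entries $\sum_j\omega_{ij}$; $\Lambda=\operatorname{diag}(\lambda_1,\dots,\lambda_n)$. $\Omega_S(\omega,\lambda)$ is the $3n\times3n$ block diagonal matrix with diagonal blocks $\Omega+\Lambda,\Omega+\Lambda,\Omega$ for cylinders and $\Omega+\Lambda,\Omega+\alpha\Lambda,\Omega+\beta\Lambda$ for ellipsoids. A $1$-extension of $G$ is a graph obtained by deleting an edge $v_av_b$ of $G$ and adding a new vertex $v_0$ and three new edges $v_0v_a,v_0v_b,v_0v_c$ for some vertex $v_c\in V\setminus\{v_a,v_b\}$. *)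

(* Defs.v *)
From HB Require Import structures.
From mathcomp Require Import all_boot all_order all_algebra.
From mathcomp Require Import reals.
From mathcomp Require Import mpoly.

Set Implicit Arguments.
Unset Strict Implicit.
Unset Printing Implicit Defensive.

Import Order.TTheory GRing.Theory Num.Theory.
Local Open Scope ring_scope.

Inductive surface_type := Cylinders | Ellipsoids of rat & rat.

(* The coefficients (c_0, c_1, c_2) of the quadratic form defining the
   surfaces: x^2 + y^2 for cylinders, x^2 + alpha y^2 + beta z^2 for
   ellipsoids. *)
Definition surface_coef (R : realType) (T : surface_type) (k : 'I_3) : R :=
  match T with
  | Cylinders => [:: 1; 1; 0]`_k
  | Ellipsoids alpha beta => [:: 1; ratr alpha; ratr beta]`_k
  end.

Definition surface_form (R : realType) (T : surface_type) (x : 'rV[R]_3) : R :=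
  \sum_(k < 3) surface_coef R T k * x 0 k ^+ 2.

(* s_i : (x, y, 0) for cylinders, (x, alpha y, beta z) for ellipsoids. *)
Definition surface_normal (R : realType) (T : surface_type) (x : 'rV[R]_3) :
    'rV[R]_3 :=
  \row_(k < 3) (surface_coef R T k * x 0 k).

Definition surface_ell (T : surface_type) : nat :=
  if T is Cylinders then 2%N else 0%N.

Definition surface_mu (T : surface_type) : nat :=
  if T is Cylinders then 6%N else 3%N.

(* Positivity of the parameters is part of [framework_on]. *)
Record surface_family (R : realType) (n : nat) := SurfaceFamily {
  kind : surface_type;
  param : 'I_n -> R
}.

Definition framework_on (R : realType) (n : nat) (S : surface_family R n)
    (p : 'I_n -> 'rV[R]_3) : Prop :=
  forall i, 0 < param S i /\ surface_form (kind S) (p i) = param S i.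

Definition induced (R : realType) (T : surface_type) (n : nat)
    (q : 'I_n -> 'rV[R]_3) : surface_family R n :=
  SurfaceFamily T (fun i => surface_form T (q i)).

(* A graph on {v_1, ..., v_n} is given by its set of edges. *)
Definition simple_graph (n : nat) (E : {set {set 'I_n}}) : Prop :=
  forall e, e \in E -> #|e| = 2%N.

(* The old vertex i becomes [lift ord0 i]; the new vertex v_0 is [ord0]. *)
Definition one_extension (n : nat) (E : {set {set 'I_n}})
    (E' : {set {set 'I_n.+1}}) : Prop :=
  exists a b c : 'I_n,
    [/\ a != b, [set a; b] \in E, c != a, c != b &
      E' = [set lift ord0 @: (e : {set 'I_n}) | e in E :\ [set a; b]]
           :|: [set [set ord0; lift ord0 a]; [set ord0; lift ord0 b];
                    [set ord0; lift ord0 c]]].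

(* For an edge e = {u, w} and v = u, the sum below has the single term
   p u - p w. *)
Definition edge_row (R : realType) (n : nat) (p : 'I_n -> 'rV[R]_3)
    (e : {set 'I_n}) : 'rV[R]_(n * 3) :=
  mxvec (\matrix_(v < n)
    (if v \in e then \sum_(w in e :\ v) (p v - p w) else 0)).

Definition vertex_row (R : realType) (T : surface_type) (n : nat)
    (p : 'I_n -> 'rV[R]_3) (i : 'I_n) : 'rV[R]_(n * 3) :=
  mxvec (\matrix_(v < n) (if v == i then surface_normal T (p i) else 0)).

Definition rigidity_matrix (R : realType) (n : nat) (S : surface_family R n)
    (E : {set {set 'I_n}}) (p : 'I_n -> 'rV[R]_3) : 'M[R]_(#|E| + n, n * 3) :=
  col_mx (\matrix_(k < #|E|) edge_row p (enum_val k))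
         (\matrix_(i < n) vertex_row (kind S) p i).

(* rank = 3n - l, without truncated subtraction. *)
Definition infinitesimally_rigid (R : realType) (n : nat) (S : surface_family R n)
    (E : {set {set 'I_n}}) (p : 'I_n -> 'rV[R]_3) : Prop :=
  (\rank (rigidity_matrix S E p) + surface_ell (kind S) = 3 * n)%N.

(* Only the values of omega on E matter, here and in [stress_weight]. *)
Definition equilibrium_stress (R : realType) (n : nat) (S : surface_family R n)
    (E : {set {set 'I_n}}) (p : 'I_n -> 'rV[R]_3)
    (omega : {set 'I_n} -> R) (lambda : 'I_n -> R) : Prop :=
  row_mx (\row_(k < #|E|) omega (enum_val k)) (\row_(i < n) lambda i)
    *m rigidity_matrix S E p = 0.

Definition stress_weight (R : realType) (n : nat) (E : {set {set 'I_n}})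
    (omega : {set 'I_n} -> R) (i j : 'I_n) : R :=
  if [set i; j] \in E then omega [set i; j] else 0.

Definition Omega_mx (R : realType) (n : nat) (E : {set {set 'I_n}})
    (omega : {set 'I_n} -> R) : 'M[R]_n :=
  \matrix_(i, j) (if i == j then \sum_(k < n) stress_weight E omega i k
                  else - stress_weight E omega i j).

Definition Lambda_mx (R : realType) (n : nat) (lambda : 'I_n -> R) : 'M[R]_n :=
  diag_mx (\row_(i < n) lambda i).

(* Blocks Omega + c_k Lambda: the third block is Omega for cylinders. *)
Definition stress_matrix (R : realType) (n : nat) (S : surface_family R n)
    (E : {set {set 'I_n}}) (omega : {set 'I_n} -> R) (lambda : 'I_n -> R) :
    'M[R]_(\sum_(k < 3) n)%N :=
  \mxdiag_(k < 3)
    (Omega_mx E omega + surface_coef R (kind S) k *: Lambda_mx lambda).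

(* rank = 3n - mu, without truncated subtraction. *)
Definition max_rank_stress (R : realType) (n : nat) (S : surface_family R n)
    (E : {set {set 'I_n}}) (omega : {set 'I_n} -> R) (lambda : 'I_n -> R) :
    Prop :=
  (\rank (stress_matrix S E omega lambda) + surface_mu (kind S) = 3 * n)%N.

Definition algebraically_independent (R : realType) (N : nat)
    (x : 'I_N -> R) : Prop :=
  forall P : {mpoly rat[N]}, (map_mpoly ratr P).@[x] = 0 -> P = 0.

Definition generic (R : realType) (n : nat) (q : 'I_n -> 'rV[R]_3) : Prop :=
  algebraically_independent (fun k => mxvec (\matrix_(v < n) q v) 0 k).

(* Main.v *)
Require Import Defs.
From HB Require Import structures.
From mathcomp Require Import all_boot all_order all_algebra.
From mathcomp Require Import reals.
From mathcomp Require Import mpoly ring zify.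

(* A statement that can be phrased as the non-vanishing of a rational polynomial
   passes from any special framework to all generic ones. Written by Cramer's
   rule, stresses (and motions) of a framework of maximal rank are rational
   polynomials in the coordinates, so infinitesimal rigidity together with a
   stress of maximal rank passes from p to the generic framework p1 obtained by
   restricting q to V. At a generic framework every stress matrix annihilates
   every infinitesimal motion (differentiate R(x) u(x) = 0 along a polynomial
   field u of motions), and a motion in the kernel of a stress matrix of maximal
   rank is a coordinatewise linear image of p1, hence trivial. Applied to
   G - v_a v_b, this shows that the stress can be chosen nonzero on v_a v_b.

   Since concentric surfaces fill space, v_0 may be put at the midpoint of
   p1(v_a) and p1(v_b). Splitting v_a v_b into two edges of doubled stress keeps
   equilibrium and raises the rank of each of the three diagonal blocks of the
   stress matrix by one (Schur complement), and the special framework so obtained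
   is infinitesimally rigid. A second transfer leads from it to q. *)

Set Implicit Arguments.
Unset Strict Implicit.
Unset Printing Implicit Defensive.

Import Order.TTheory GRing.Theory Num.Theory.
Local Open Scope ring_scope.

(** * Subrings of functions and Cramer's rule *)

(** An abstract ring of functions with the rational constants, so that closure under determinants,
    adjugates and rigidity matrices is proved once and used for both [poly_function] and
    [frame_function]. *)
Record function_ring (R : realType) (Z : Type) (C : (Z -> R) -> Prop) : Prop :=
  FunctionRing {
    fring_ext : forall f g, f =1 g -> C f -> C g;
    fring_rat : forall a : rat, C (fun=> ratr a);
    fring_add : forall f g, C f -> C g -> C (fun z => f z + g z);
    fring_mul : forall f g, C f -> C g -> C (fun z => f z * g z)
  }.

Section FunctionRing.
Variables (R : realType) (Z : Type) (C : (Z -> R) -> Prop).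
Hypothesis Cring : function_ring C.

Lemma fring_nat n : C (fun=> n%:R).
Proof.
by apply: (fring_ext Cring) (fring_rat Cring n%:R) => z; rewrite ratr_nat.
Qed.

Lemma fring_opp f : C f -> C (fun z => - f z).
Proof.
move=> Cf; apply: (fring_ext Cring) (fring_mul Cring (fring_rat Cring (-1)) Cf).
by move=> z; rewrite rmorphN1 mulN1r.
Qed.

Lemma fring_sub f g : C f -> C g -> C (fun z => f z - g z).
Proof. by move=> Cf Cg; apply: (fring_add Cring) => //; apply: fring_opp. Qed.

Lemma fring_exp f k : C f -> C (fun z => f z ^+ k).
Proof.
move=> Cf; elim: k => [|k IHk]; first exact: (fring_nat 1).
apply: (fring_ext Cring) (fring_mul Cring Cf IHk) => z.
by rewrite exprS.
Qed.

Lemma fring_sum (I : Type) (s : seq I) (Q : pred I) (F : I -> Z -> R) :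
  (forall i, Q i -> C (F i)) -> C (fun z => \sum_(i <- s | Q i) F i z).
Proof.
move=> CF; elim: s => [|i s IHs].
  by apply: (fring_ext Cring) (fring_nat 0) => z; rewrite big_nil.
have [Qi|nQi] := boolP (Q i).
  apply: (fring_ext Cring) (fring_add Cring (CF i Qi) IHs) => z.
  by rewrite big_cons Qi.
by apply: (fring_ext Cring) IHs => z; rewrite big_cons (negPf nQi).
Qed.

Lemma fring_prod (I : Type) (s : seq I) (Q : pred I) (F : I -> Z -> R) :
  (forall i, Q i -> C (F i)) -> C (fun z => \prod_(i <- s | Q i) F i z).
Proof.
move=> CF; elim: s => [|i s IHs].
  by apply: (fring_ext Cring) (fring_nat 1) => z; rewrite big_nil.
have [Qi|nQi] := boolP (Q i).
  apply: (fring_ext Cring) (fring_mul Cring (CF i Qi) IHs) => z.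
  by rewrite big_cons Qi.
by apply: (fring_ext Cring) IHs => z; rewrite big_cons (negPf nQi).
Qed.

Definition fring_mx m n (A : Z -> 'M[R]_(m, n)) :=
  forall i j, C (fun z => A z i j).

Lemma fring_mx_mul m n p (A : Z -> 'M_(m, n)) (B : Z -> 'M_(n, p)) :
  fring_mx A -> fring_mx B -> fring_mx (fun z => A z *m B z).
Proof.
move=> CA CB i j.
apply: (fring_ext Cring) (fun z => \sum_k A z i k * B z k j) _ _ _.
  by move=> z; rewrite mxE.
by apply: fring_sum => k _; apply: (fring_mul Cring).
Qed.

Lemma fring_mx_sub m n (A B : Z -> 'M_(m, n)) :
  fring_mx A -> fring_mx B -> fring_mx (fun z => A z - B z).
Proof.
move=> CA CB i j; apply: (fring_ext Cring) (fring_sub (CA i j) (CB i j)).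
by move=> z; rewrite !mxE.
Qed.

Lemma fring_mx_scale m n (a : Z -> R) (A : Z -> 'M_(m, n)) :
  C a -> fring_mx A -> fring_mx (fun z => a z *: A z).
Proof.
move=> Ca CA i j; apply: (fring_ext Cring) (fring_mul Cring Ca (CA i j)).
by move=> z; rewrite !mxE.
Qed.

Lemma fring_mx_nat m n (A : 'M[nat]_(m, n)) :
  fring_mx (fun=> map_mx (fun k => k%:R) A).
Proof.
by move=> i j; apply: (fring_ext Cring) (fring_nat (A i j)) => z; rewrite mxE.
Qed.

Lemma fring_mx_1 n : fring_mx (fun=> 1%:M : 'M_n).
Proof.
by move=> i j; apply: (fring_ext Cring) (fring_nat (i == j)) => z; rewrite mxE.
Qed.

Lemma fring_mx_mxsub m n m' n' (f : 'I_m' -> 'I_m) (g : 'I_n' -> 'I_n)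
    (A : Z -> 'M_(m, n)) :
  fring_mx A -> fring_mx (fun z => mxsub f g (A z)).
Proof.
move=> CA i j; apply: (fring_ext Cring) (CA (f i) (g j)) => z.
by rewrite mxE.
Qed.

Lemma fring_det n (A : Z -> 'M_n) : fring_mx A -> C (fun z => \det (A z)).
Proof.
move=> CA; apply: fring_sum => s _; apply: (fring_mul Cring).
  by apply: fring_exp; apply: (fring_ext Cring) (fring_opp (fring_nat 1)).
by apply: fring_prod.
Qed.

Lemma fring_mx_adj n (A : Z -> 'M_n) : fring_mx A -> fring_mx (fun z => \adj (A z)).
Proof.
move=> CA i j; apply: (fring_ext Cring) (fun z => cofactor (A z) j i) _ _ _.
  by move=> z; rewrite mxE.
apply: (fring_mul Cring).
  by apply: fring_exp; apply: (fring_ext Cring) (fring_opp (fring_nat 1)).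
apply: fring_det => k l.
apply: (fring_ext Cring) (CA (lift j k) (lift i l)) => z.
by rewrite !mxE.
Qed.

End FunctionRing.

(** * Polynomial functions of one real variable *)

Definition poly_function (R : realType) (f : R -> R) :=
  exists P : {poly R}, forall t, f t = P.[t].

Lemma poly_function_ring (R : realType) : function_ring (@poly_function R).
Proof.
split=> [f g fg [P fP]|a|f g [P fP] [Q gQ]|f g [P fP] [Q gQ]].
- by exists P => t; rewrite -fg.
- by exists (ratr a)%:P => t; rewrite hornerC.
- by exists (P + Q) => t; rewrite hornerD fP gQ.
- by exists (P * Q) => t; rewrite hornerM fP gQ.
Qed.

Lemma poly_function_const (R : realType) (a : R) : poly_function (fun=> a).
Proof. by exists a%:P => t; rewrite hornerC. Qed.

Lemma poly_function_id (R : realType) : poly_function (fun t : R => t).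
Proof. by exists 'X => t; rewrite hornerX. Qed.

(** A polynomial that is nonzero somewhere has fewer roots than its size, so an injective sequence
    cannot consist of roots only. *)
Lemma poly_function_neq0 (R : realType) (f : R -> R) (t : R) (u : nat -> R) :
  poly_function f -> f t != 0 -> injective u -> exists k, f (u k) != 0.
Proof.
move=> [P fP] ft0 u_inj.
have [|fu0] := boolP [exists k : 'I_(size P), f (u k) != 0].
  by move=> /existsP[k fk0]; exists k.
case/eqP: ft0; rewrite fP.
suff -> : P = 0 by rewrite horner0.
apply: (@roots_geq_poly_eq0 _ P [seq u k | k <- iota 0 (size P)]).
- apply/allP => _ /mapP[k + ->]; rewrite mem_iota add0n => ltk.
  rewrite rootE -fP; apply: contraNT fu0 => fk0.
  by apply/existsP; exists (Ordinal ltk).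
- by rewrite map_inj_uniq ?iota_uniq.
- by rewrite size_map size_iota.
Qed.

(** Replaces continuity at 0: a polynomial with infinitely many roots vanishes identically. It
    allows a factor [t] to be cancelled before setting t = 0. *)
Lemma poly_function_extend0 (R : realType) (f : R -> R) :
  poly_function f -> (forall t, t != 0 -> f t = 0) -> f 0 = 0.
Proof.
move=> Pf f0; apply: contraTeq isT => f00.
have [|k] := @poly_function_neq0 R f 0 (fun k => k.+1%:R) Pf f00.
  by move=> i j /eqP; rewrite eqr_nat => /eqP[].
by rewrite f0 ?eqxx // pnatr_eq0.
Qed.

(* The coordinates of w0 are replaced by natural numbers one at a time. *)
Lemma nat_point_neq0 (R : realType) m (F : 'rV[R]_m -> R) (w0 : 'rV[R]_m) :
  (forall w i, poly_function (fun t => F (w + t *: delta_mx 0 i))) ->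
  F w0 != 0 ->
  exists w : 'rV[nat]_m, F (map_mx (fun k => k%:R) w) != 0.
Proof.
move=> PF Fw0.
suff H k : (k <= m)%N ->
    exists w : 'rV[R]_m,
      (forall i : 'I_m, (i < k)%N -> exists c : nat, w 0 i = c%:R) /\ F w != 0.
  have [w [wnat Fw]] := H m (leqnn m); pose v := \row_i Num.truncn (w 0 i); exists v.
  suff -> : map_mx (fun k => k%:R) v = w by [].
  by apply/rowP => i; have [c wc] := wnat i (ltn_ord i); rewrite !mxE wc natrK.
elim: k => [|k IHk] ltk; first by exists w0.
have [w [wnat Fw]] := IHk (ltnW ltk); pose i := Ordinal ltk.
have [||c Fc] := @poly_function_neq0 R _ 0 (fun c => c%:R - w 0 i) (PF w i).
- by rewrite scale0r addr0.
- by move=> c d /addIr /eqP; rewrite eqr_nat => /eqP.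
exists (w + (c%:R - w 0 i) *: delta_mx 0 i); split=> // j ltj.
rewrite !mxE eqxx /=; have [->|nij] := eqVneq j i.
  by exists c; rewrite mulr1 addrC subrK.
have [|d wd] := wnat j; last by exists d; rewrite mulr0 addr0.
by move: ltj; rewrite ltnS leq_eqVlt -[k]/(val i) (inj_eq val_inj) (negPf nij).
Qed.

(** * Maximal minors and Cramer's rule *)

Lemma exists_minor (F : fieldType) m n (A : 'M[F]_(m, n)) :
  {f : 'I_(\rank A) -> 'I_m &
    {g : 'I_(\rank A) -> 'I_n | \det (mxsub f g A) != 0}}.
Proof.
pose B := rowsub (maxrankfun A) A.
have BfT : row_full B^T by rewrite /row_full mxrank_tr; apply: maxrowsub_free.
exists (maxrankfun A), (fullrankfun BfT).
have := fullrowsub_unit BfT.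
rewrite unitmxE unitfE -det_tr; congr (\det _ != 0).
by apply/matrixP => i j; rewrite !mxE.
Qed.

Lemma minor_rank (F : fieldType) m n r (f : 'I_r -> 'I_m) (g : 'I_r -> 'I_n)
    (A : 'M[F]_(m, n)) :
  \det (mxsub f g A) != 0 -> (r <= \rank A)%N.
Proof.
rewrite -unitfE -unitmxE -row_free_unit /row_free => /eqP <-.
have -> : mxsub f g A = rowsub f 1%:M *m A *m colsub g 1%:M.
  by rewrite -mulmxA mulmx_colsub mulmx1 -mxsub_mul mul1mx.
apply: leq_trans (mxrankM_maxl _ _) (mxrankM_maxr _ _).
Qed.

(** A denominator-free form of A = A_g M^-1 A_f, with M the minor. The columns [g] span the column
    space, so A = A_g Y and A_f = M Y. Being polynomial in the entries, the identity can be
    transferred between frameworks. *)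
Lemma cramer_rank (F : fieldType) m n r (f : 'I_r -> 'I_m) (g : 'I_r -> 'I_n)
    (A : 'M[F]_(m, n)) :
  (\rank A <= r)%N -> \det (mxsub f g A) != 0 ->
  \det (mxsub f g A) *: A = colsub g A *m \adj (mxsub f g A) *m rowsub f A.
Proof.
move=> rkA detM; set M := mxsub f g A.
have MU : M \in unitmx by rewrite unitmxE unitfE.
have rkB : (r <= \rank (colsub g A)^T)%N.
  rewrite mxrank_tr -[X in (X <= _)%N](eqP (_ : row_free M)) ?row_free_unit //.
  have -> : M = rowsub f 1%:M *m colsub g A.
    by rewrite mul_rowsub_mx mul1mx -mxsub_comp.
  exact: mxrankM_maxr.
have sBA : ((colsub g A)^T <= A^T)%MS.
  by rewrite -[A in colsub _ A]mulmx1 -mulmx_colsub trmx_mul submxMl.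
have : (A^T <= (colsub g A)^T)%MS.
  by rewrite -(geq_leqif (mxrank_leqif_sup sBA)) mxrank_tr (leq_trans rkA).
case/submxP => Y /(congr1 trmx); rewrite trmx_mul !trmxK => defA.
have -> : rowsub f A = M *m Y^T.
  by rewrite {1}defA -mul_rowsub_mx -mxsub_comp.
by rewrite mulmxA -(mulmxA _ _ M) mul_adj_mx -mulmxA mul_scalar_mx -scalemxAr -defA.
Qed.

(** * Rigidity matrices and stresses *)

Definition frame_vec (R : realType) n (p : 'I_n -> 'rV[R]_3) : 'rV[R]_(n * 3) :=
  mxvec (\matrix_(v < n) p v).

Lemma frame_vec_surj (R : realType) n (u : 'rV[R]_(n * 3)) :
  frame_vec (fun i => row i (vec_mx u)) = u.
Proof.
rewrite /frame_vec -[RHS]vec_mxK; congr mxvec.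
by apply/row_matrixP => i; rewrite rowK.
Qed.

Lemma mxvec_dot (R : comPzRingType) m n (A B : 'M[R]_(m, n)) :
  (mxvec A *m (mxvec B)^T) 0 0 = \sum_i \sum_j A i j * B i j.
Proof.
rewrite mxE pair_big /= (reindex _ (curry_mxvec_bij _ _)) /=.
by apply: eq_bigr => -[i j] _; rewrite !mxE !mxvecE.
Qed.

Section FrameFunction.
Variables (R : realType) (n : nat).
Implicit Types (f : ('I_n -> 'rV[R]_3) -> R).

(** The coefficients are rational because genericity controls only such polynomials. *)
Definition frame_function f :=
  exists P : {mpoly rat[n * 3]},
    forall p, f p = (map_mpoly ratr P).@[fun k => frame_vec p 0 k].

Lemma frame_function_ring : function_ring frame_function.
Proof.
split=> [f g fg [P fP]|a|f g [P fP] [Q gQ]|f g [P fP] [Q gQ]].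
- by exists P => t; rewrite -fg.
- by exists a%:MP => t; rewrite map_mpolyC mevalC.
- by exists (P + Q) => t; rewrite rmorphD mevalD fP gQ.
- by exists (P * Q) => t; rewrite rmorphM mevalM fP gQ.
Qed.

Lemma frame_function_coord i k : frame_function (fun p => p i 0 k).
Proof.
exists 'X_(mxvec_index i k) => p.
by rewrite map_mpolyX mevalXU /frame_vec mxvecE mxE.
Qed.

(* The only consequence of genericity that is used; it passes to subframeworks. *)
Definition generic_frame (q : 'I_n -> 'rV[R]_3) :=
  forall f, frame_function f -> f q = 0 -> forall p, f p = 0.

Lemma generic_frame_neq0 q f p :
  generic_frame q -> frame_function f -> f p != 0 -> f q != 0.
Proof. by move=> gq Ff; apply: contraNneq => /(gq f Ff) ->. Qed.

Lemma generic_is_generic_frame q : generic q -> generic_frame q.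
Proof.
move=> gq f [P fP] fq p; rewrite fP (gq P) ?rmorph0 ?meval0 //.
by rewrite -fP.
Qed.

End FrameFunction.

(** A polynomial in the coordinates of the old vertices is also one in all coordinates, and every
    placement of the old vertices extends to the new one. *)
Lemma generic_frame_lift (R : realType) n (q : 'I_n.+1 -> 'rV[R]_3) :
  generic_frame q -> generic_frame (fun i => q (lift ord0 i)).
Proof.
move=> gq f [P fP] fq p.
pose p' i := oapp p 0 (unlift ord0 i).
have fp' : f (fun i => p' (lift ord0 i)) = f p.
  by rewrite !fP; apply: meval_eq => k; congr (mxvec _ 0 k);
    apply/matrixP => i j; rewrite !mxE /p' liftK.
rewrite -fp'; apply: (gq (fun q => f (fun i => q (lift ord0 i)))) => //.
have FR := @frame_function_ring R n.+1.
(* Since [ratr] is injective, the real image of [P] has the same monomials as [P]. *)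
apply: (fring_ext FR) (fun q => \sum_(m <- msupp P)
  ratr P@_m * \prod_k frame_vec (fun i => q (lift ord0 i)) 0 k ^+ m k) _ _ _.
  move=> x; rewrite fP mevalE.
  rewrite [RHS](perm_big (msupp P)) /=; last first.
    apply: uniq_perm; rewrite ?msupp_uniq // => m.
    by rewrite !mcoeff_msupp mcoeff_map_mpoly fmorph_eq0.
  by apply: eq_bigr => m _; rewrite mcoeff_map_mpoly.
apply: (fring_sum FR) => m _; apply: (fring_mul FR); first exact: (fring_rat FR).
apply: (fring_prod FR) => k _; apply: (fring_exp FR).
case/mxvec_indexP: k => i k.
apply: (fring_ext FR) (frame_function_coord R (lift ord0 i) k) => x.
by rewrite /frame_vec mxvecE mxE.
Qed.

Section RigidityMatrix.
Variables (R : realType) (T : surface_type) (n : nat) (E : {set {set 'I_n}}).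
Implicit Types (p u : 'I_n -> 'rV[R]_3) (om : {set 'I_n} -> R) (la : 'I_n -> R).
Implicit Types w : 'rV[R]_(#|E| + n).

Definition rig_mx p := rigidity_matrix (induced T p) E p.

(** Half the derivative of the squared edge length when [p] moves with velocity [u]; [surf_form] is
    likewise half the derivative of the surface equation. *)
Definition edge_form p u i j :=
  \sum_(k < 3) (p i 0 k - p j 0 k) * (u i 0 k - u j 0 k).

Definition surf_form p u i := \sum_(k < 3) surface_coef R T k * p i 0 k * u i 0 k.

Definition motion p u :=
  (forall i j, i != j -> [set i; j] \in E -> edge_form p u i j = 0) /\
  (forall i, surf_form p u i = 0).

Lemma edge_row_dot p u i j : i != j ->
  (edge_row p [set i; j] *m (frame_vec u)^T) 0 0 = edge_form p u i j.
Proof.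
move=> nij; rewrite mxvec_dot.
transitivity (\sum_(v in [set i; j])
    \sum_k (\sum_(w in [set i; j] :\ v) (p v - p w)) 0 k * u v 0 k).
  rewrite [RHS]big_mkcond /=; apply: eq_bigr => v _.
  under eq_bigr => k _ do rewrite !mxE.
  case: ifP => // _; apply: big1 => k _; by rewrite mxE mul0r.
rewrite big_setU1 ?inE //= big_set1 -big_split /=.
have -> : [set i; j] :\ i = [set j] by rewrite setU1K ?inE.
have -> : [set i; j] :\ j = [set i] by rewrite setUC setU1K // inE eq_sym.
by apply: eq_bigr => k _; rewrite !big_set1 !mxE; ring.
Qed.

Lemma vertex_row_dot p u i :
  (vertex_row T p i *m (frame_vec u)^T) 0 0 = surf_form p u i.
Proof.
rewrite mxvec_dot (bigD1 i) //= [X in _ + X]big1 ?addr0 => [|v /negPf nvi]; last first.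
  by apply: big1 => k _; rewrite !mxE nvi mxE mul0r.
by apply: eq_bigr => k _; rewrite !mxE eqxx !mxE.
Qed.

Lemma row_rig_mx p (k : 'I_(#|E| + n)) :
  row k (rig_mx p) = match split k with
    | inl e => edge_row p (enum_val e) | inr i => vertex_row T p i end.
Proof.
rewrite -[k in LHS](splitK k); case: (split k) => i.
  by rewrite /rig_mx /rigidity_matrix /= rowKu rowK.
by rewrite /rig_mx /rigidity_matrix /= rowKd rowK.
Qed.

Lemma rig_mx_dot p u k :
  (rig_mx p *m (frame_vec u)^T) k 0 = (row k (rig_mx p) *m (frame_vec u)^T) 0 0.
Proof. by rewrite -row_mul [RHS]mxE. Qed.

Definition stress_vec om la : 'rV[R]_(#|E| + n) :=
  row_mx (\row_(k < #|E|) om (enum_val k)) (\row_(i < n) la i).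

(** The sum has at most one term and is 0 off [E], so a coordinate is read off without a proof of
    membership. *)
Definition edge_stress w (e : {set 'I_n}) : R :=
  \sum_(k < #|E| | enum_val k == e) w 0 (lshift n k).

Definition vertex_stress w (i : 'I_n) : R := w 0 (rshift #|E| i).

Lemma stress_vecK w : stress_vec (edge_stress w) (vertex_stress w) = w.
Proof.
rewrite -[RHS]hsubmxK; congr row_mx; apply/rowP => k; rewrite !mxE //.
rewrite /edge_stress (big_pred1 k) // => l.
by rewrite (inj_eq enum_val_inj).
Qed.

Lemma stress_vec_mul om la p :
  stress_vec om la *m rig_mx p =
  \sum_(e in E) om e *: edge_row p e + \sum_i la i *: vertex_row T p i.
Proof.
rewrite mul_row_col !mulmx_sum_row; congr (_ + _).
  by rewrite [RHS]big_enum_val; apply: eq_bigr => k _; rewrite mxE rowK.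
by apply: eq_bigr => k _; rewrite mxE rowK.
Qed.

(** The [k]-th diagonal block of [stress_matrix]. Ranks of blocks add up, so the three coordinates
    are treated separately. *)
Definition stress_block om la (k : 'I_3) : 'M[R]_n :=
  Omega_mx E om + surface_coef R T k *: Lambda_mx la.

Definition coord_col p k : 'cV[R]_n := \col_i p i 0 k.

Lemma stress_weight_sym om i j : stress_weight E om i j = stress_weight E om j i.
Proof. by rewrite /stress_weight setUC. Qed.

Hypothesis E_simple : simple_graph E.

Lemma edge_cases e : e \in E -> exists i j, i != j /\ e = [set i; j].
Proof. by move/E_simple/eqP/cards2P. Qed.

Lemma loop_notin i : [set i; i] \notin E.
Proof. by apply/negP => /E_simple; rewrite setUid cards1. Qed.

(** Every entry of R(p) u is a bilinear form symmetric in [p] and [u]. *)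
Lemma rig_mx_sym p u :
  rig_mx p *m (frame_vec u)^T = rig_mx u *m (frame_vec p)^T.
Proof.
apply/colP => k; rewrite !rig_mx_dot !row_rig_mx.
case: (split k) => [e|i].
  have [i [j [nij ->]]] := edge_cases (enum_valP e).
  rewrite !edge_row_dot //.
  by apply: eq_bigr => l _; rewrite mulrC.
by rewrite !vertex_row_dot; apply: eq_bigr => l _; rewrite mulrAC.
Qed.

Lemma motionP p u : rig_mx p *m (frame_vec u)^T = 0 <-> motion p u.
Proof.
split=> [Ru0|[ed sf]].
  split=> [i j nij eE|i].
    have := congr1 (fun M : 'cV_ _ => M (lshift n (enum_rank_in eE [set i; j])) 0) Ru0.
    rewrite rig_mx_dot row_rig_mx -[lshift _ _]/(unsplit (inl _)) unsplitK.
    by rewrite enum_rankK_in // edge_row_dot // mxE.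
  have := congr1 (fun M : 'cV_ _ => M (rshift #|E| i) 0) Ru0.
  rewrite rig_mx_dot row_rig_mx -[rshift _ _]/(unsplit (inr _)) unsplitK.
  by rewrite vertex_row_dot mxE.
apply/colP => k; rewrite [RHS]mxE rig_mx_dot row_rig_mx.
case: (split k) => [e|i]; last by rewrite vertex_row_dot sf.
have [i [j [nij eij]]] := edge_cases (enum_valP e).
by rewrite eij edge_row_dot // ed // -eij enum_valP.
Qed.

Lemma Omega_mx_mul om p i k :
  (Omega_mx E om *m coord_col p k) i 0 =
  \sum_j stress_weight E om i j * (p i 0 k - p j 0 k).
Proof.
rewrite mxE (bigD1 i) //= !mxE eqxx mulr_suml [in RHS](bigD1 i) //=.
rewrite [in LHS](bigD1 i) //= {1 3}/stress_weight (negPf (loop_notin i)) !mul0r !add0r.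
rewrite -big_split /=; apply: eq_bigr => j nji.
by rewrite !mxE eq_sym (negPf nji); ring.
Qed.

(** At vertex i and coordinate k both sides equal the sum over j of omega_ij (p_i - p_j)_k, plus c_k
    lambda_i (p_i)_k. Equilibrium thus says that each coordinate vector lies in the kernel of its
    own block. *)
Lemma stress_vec_rig_mx om la p :
  stress_vec om la *m rig_mx p =
  mxvec (\matrix_(i, k) (stress_block om la k *m coord_col p k) i 0).
Proof.
apply: (can_inj vec_mxK); rewrite mxvecK stress_vec_mul.
apply/matrixP => i k; rewrite raddfD /= !raddf_sum /= [LHS]mxE [RHS]mxE.
rewrite /stress_block mulmxDl [RHS]mxE Omega_mx_mul; congr (_ + _); last first.
  rewrite -scalemxAl mul_diag_mx !mxE summxE (bigD1 i) //= big1 ?addr0 => [|j nji].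
    by rewrite linearZ /= mxvecK !mxE eqxx !mxE; ring.
  by rewrite linearZ /= mxvecK !mxE eq_sym (negPf nji) mxE mulr0.
rewrite summxE.
(* Each edge at [i] is paired with its other endpoint [j], which turns the sum over edges into a sum
   over vertices. *)
transitivity (\sum_(e in E) \sum_(j | (j != i) && (e == [set i; j]))
    om e * (p i 0 k - p j 0 k)).
  apply: eq_bigr => e eE; rewrite linearZ /= mxvecK !mxE.
  have eqij j : j != i -> (e == [set i; j]) = (i \in e) && (j \in e).
    move=> nji; rewrite eq_sym eqEcard subUset !sub1set cards2 eq_sym nji.
    by rewrite (E_simple eE) andbT.
  case: ifP => [ie|ie]; last first.
    by rewrite mxE mulr0 big1 // => j /andP[/eqij ->]; rewrite ie.
  rewrite summxE mulr_sumr; apply: eq_big => [j|j _]; last by rewrite !mxE.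
  by rewrite !inE; case: eqVneq => //= /eqij ->; rewrite ie.
rewrite (exchange_big_dep predT) //= [RHS](bigID (fun j => j == i)) /=.
rewrite big_pred1_eq /= subrr mulr0 add0r big_mkcond [RHS]big_mkcond /=.
apply: eq_bigr => j _; have [->|nji] := eqVneq j i.
  by rewrite big1 // => e; rewrite andbF.
rewrite /stress_weight; case: ifP => [ijE|/negP ijE].
  rewrite (big_pred1 [set i; j]) // => e /=; rewrite andbC.
  by case: eqP => [->|].
rewrite mul0r big1 // => e /andP[eE /eqP e_ij]; by rewrite e_ij in eE.
Qed.

Lemma equilibriumP om la p :
  stress_vec om la *m rig_mx p = 0 <->
  forall k, stress_block om la k *m coord_col p k = 0.
Proof.
rewrite stress_vec_rig_mx; split=> [M0 k|M0].
  apply/colP => i; move/(congr1 vec_mx): M0; rewrite mxvecK raddf0.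
  by move/matrixP/(_ i k); rewrite !mxE.
apply: (can_inj vec_mxK); rewrite mxvecK raddf0; apply/matrixP => i k.
by rewrite mxE M0 !mxE.
Qed.

End RigidityMatrix.

(** * Generic frameworks *)

Definition row_block (R : realType) T n (E : {set {set 'I_n}})
    (w : 'rV[R]_(#|E| + n)) (k : 'I_3) : 'M[R]_n :=
  stress_block T E (edge_stress w) (vertex_stress w) k.

Section Polynomiality.
Variables (R : realType) (Z : Type) (C : (Z -> R) -> Prop).
Hypothesis Cring : function_ring C.
Variables (T : surface_type) (n : nat) (E : {set {set 'I_n}}).

(** The rationality of alpha and beta enters here: it gives the rigidity matrix entries that are
    polynomials with rational coefficients. *)
Lemma fring_surface_coef k : C (fun=> surface_coef R T k).
Proof.
pose c : rat := match T with Cylinders => [:: 1; 1; 0]`_k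
                | Ellipsoids alpha beta => [:: 1; alpha; beta]`_k end.
apply: (fring_ext Cring) (fring_rat Cring c) => z; rewrite {}/c /surface_coef.
by case: T => [|alpha beta]; case: k => -[|[|[|//]]] ? /=;
  rewrite ?rmorph1 ?rmorph0.
Qed.

Lemma fring_rig_mx (p : Z -> 'I_n -> 'rV[R]_3) :
  (forall i k, C (fun z => p z i 0 k)) -> fring_mx C (fun z => rig_mx T E (p z)).
Proof.
move=> Cp r c.
apply: (fring_ext Cring) (fun z => row r (rig_mx T E (p z)) 0 c) _ _ _.
  by move=> z; rewrite mxE.
case/mxvec_indexP: c => i k.
apply: (fring_ext Cring) (fun z => match split r with
   | inl e => (if i \in enum_val e
               then \sum_(v in enum_val e :\ i) (p z i 0 k - p z v 0 k) else 0)
   | inr j => if i == j then surface_coef R T k * p z j 0 k else 0 end) _ _ _.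
  move=> z; rewrite row_rig_mx; case: (split r) => e.
    rewrite /edge_row mxvecE mxE; case: ifP => _; rewrite ?mxE // summxE.
    by apply: eq_bigr => j _; rewrite !mxE.
  by rewrite /vertex_row mxvecE mxE; case: ifP => _; rewrite !mxE.
case: (split r) => e.
  case: (i \in enum_val e); last exact: (fring_nat Cring 0).
  by apply: (fring_sum Cring) => v _; apply: (fring_sub Cring).
case: (i == e); last exact: (fring_nat Cring 0).
by apply: (fring_mul Cring) => //; apply: fring_surface_coef.
Qed.

Lemma fring_row_block (w : Z -> 'rV[R]_(#|E| + n)) k :
  fring_mx C w -> fring_mx C (fun z => row_block T (w z) k).
Proof.
move=> Cw i j.
have Cs a b : C (fun z => stress_weight E (edge_stress (w z)) a b).
  rewrite /stress_weight; case: (_ \in E); last exact: (fring_nat Cring 0).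
  by apply: (fring_sum Cring) => l _; apply: Cw.
apply: (fring_ext Cring) (fun z =>
  (if i == j then \sum_(l < n) stress_weight E (edge_stress (w z)) i l
   else - stress_weight E (edge_stress (w z)) i j) +
  surface_coef R T k * (vertex_stress (w z) i *+ (i == j))) _ _ _.
  by move=> z; rewrite !mxE.
apply: (fring_add Cring).
  by case: (i == j); [apply: (fring_sum Cring) | apply: (fring_opp Cring)].
apply: (fring_mul Cring); first exact: fring_surface_coef.
by case: (i == j); [apply: Cw | apply: (fring_nat Cring 0)].
Qed.

End Polynomiality.

Section GenericFrameworks.
Variables (R : realType) (T : surface_type) (n : nat) (E : {set {set 'I_n}}).
Implicit Types (p q u : 'I_n -> 'rV[R]_3) (w : 'rV[R]_(#|E| + n)).

Lemma row_blockZ a w k : row_block T (a *: w) k = a *: row_block T w k.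
Proof.
have sZ i j : stress_weight E (edge_stress (a *: w)) i j =
              a * stress_weight E (edge_stress w) i j.
  rewrite /stress_weight; case: ifP => _; rewrite ?mulr0 // /edge_stress.
  by rewrite mulr_sumr; apply: eq_bigr => l _; rewrite mxE.
apply/matrixP => i j; rewrite !mxE /vertex_stress !mxE mulrDr; congr (_ + _).
  case: ifP => _; last by rewrite sZ mulrN.
  by rewrite mulr_sumr; apply: eq_bigr => l _.
by rewrite mulrCA -mulrnAr.
Qed.

Lemma frame_function_rig_mx : fring_mx (@frame_function R n) (rig_mx T E).
Proof.
apply: fring_rig_mx => [|i k]; first exact: frame_function_ring.
exact: frame_function_coord.
Qed.

(** For a nonzero minor M of maximal size, a polynomial multiple of a projection onto the left
    kernel of R(p): by [cramer_rank] the result is a stress for every [w], and it is det M times [w]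
    when [w] is already a stress. *)
Definition cramer_stress r (f : 'I_r -> 'I_(#|E| + n)) (g : 'I_r -> 'I_(n * 3))
    p w : 'rV[R]_(#|E| + n) :=
  let M := mxsub f g (rig_mx T E p) in
  \det M *: w - w *m colsub g (rig_mx T E p) *m \adj M *m rowsub f 1%:M.

Lemma fring_cramer_stress (Z : Type) (C : (Z -> R) -> Prop) r
    (f : 'I_r -> 'I_(#|E| + n)) (g : 'I_r -> 'I_(n * 3))
    (p : Z -> 'I_n -> 'rV[R]_3) (w : Z -> 'rV[R]_(#|E| + n)) :
  function_ring C -> (forall i k, C (fun z => p z i 0 k)) -> fring_mx C w ->
  fring_mx C (fun z => cramer_stress f g (p z) (w z)).
Proof.
move=> Cring Cp Cw; have CR := fring_rig_mx (E := E) Cring T Cp.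
have CM := fring_mx_mxsub Cring f g CR.
apply: (fring_mx_sub Cring).
  by apply: (fring_mx_scale Cring) => //; apply: (fring_det Cring).
apply: (fring_mx_mul Cring); last first.
  by apply: (fring_mx_mxsub Cring); apply: (fring_mx_1 Cring).
apply: (fring_mx_mul Cring); last exact: (fring_mx_adj Cring).
apply: (fring_mx_mul Cring) => //; exact: (fring_mx_mxsub Cring).
Qed.

(** The rank bound makes a maximal minor at [p] maximal at [q] too, so [cramer_stress] produces
    stresses at [q]. Ranks do not drop, because they are witnessed by rational polynomials that are
    nonzero at [p], hence at [q]. *)
Lemma stress_transfer p q w :
  generic_frame q -> (\rank (rig_mx T E q) <= \rank (rig_mx T E p))%N ->
  w *m rig_mx T E p = 0 ->
  \rank (rig_mx T E q) = \rank (rig_mx T E p) /\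
  exists w', w' *m rig_mx T E q = 0 /\
    forall k, (\rank (row_block T w k) <= \rank (row_block T w' k))%N.
Proof.
move=> gq rkq wp.
have [f [g detp]] := exists_minor (rig_mx T E p).
have detq : \det (mxsub f g (rig_mx T E q)) != 0.
  apply: (generic_frame_neq0 (f := fun x => \det (mxsub f g (rig_mx T E x)))) detp => //.
  apply: (fring_det (@frame_function_ring R n)).
  exact: (fring_mx_mxsub (@frame_function_ring R n)) frame_function_rig_mx.
split; first by apply/eqP; rewrite eqn_leq rkq (minor_rank detq).
(* One minor of each block of the Cramer stress, of the size and position of a maximal minor for
   [w]: a single nonzero value of [F] bounds all three ranks. *)
pose F (x : 'I_n -> 'rV[R]_3) v := \prod_(k < 3) \det (mxsub (projT1 (exists_minor (row_block T w k)))
  (sval (projT2 (exists_minor (row_block T w k))))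
  (row_block T (cramer_stress f g x v) k)).
have F_ring (Z : Type) (C : (Z -> R) -> Prop) (x : Z -> 'I_n -> 'rV[R]_3) v :
    function_ring C -> (forall i k, C (fun z => x z i 0 k)) -> fring_mx C v ->
    C (fun z => F (x z) (v z)).
  move=> Cring Cx Cv; apply: (fring_prod Cring) => k _.
  apply: (fring_det Cring); apply: (fring_mx_mxsub Cring).
  by apply: (fring_row_block Cring); apply: fring_cramer_stress.
have Fpw : F p w != 0.
  apply/prodf_neq0 => k _.
  rewrite /cramer_stress.
  have -> : w *m colsub g (rig_mx T E p) = 0.
    by rewrite mulmx_colsub wp linear0.
  rewrite !mul0mx subr0 row_blockZ linearZ /= detZ mulf_neq0 ?expf_neq0 //.
  exact: (svalP (projT2 (exists_minor (row_block T w k)))).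
(* The real entries of [w] would spoil the rationality of the coefficients; a parameter vector of
   natural numbers keeps it. *)
have [v Fpv] : exists v : 'rV[nat]_(#|E| + n), F p (map_mx (fun k => k%:R) v) != 0.
  apply: nat_point_neq0 Fpw => v i.
  have PR := @poly_function_ring R.
  apply: (F_ring _ (@poly_function R)) => // [j k|j k].
    exact: poly_function_const.
  apply: (fring_ext PR) (fun t => v j k + t * delta_mx 0 i j k) _ _ _.
    by move=> t; rewrite !mxE.
  apply: (fring_add PR); first exact: poly_function_const.
  by apply: (fring_mul PR); [apply: poly_function_id | apply: poly_function_const].
have Fqv : F q (map_mx (fun k => k%:R) v) != 0.
  apply: (generic_frame_neq0 (f := fun x => F x _)) Fpv => //.
  have FR := @frame_function_ring R n.
  apply: (F_ring _ (@frame_function R n)) => //.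
    exact: frame_function_coord.
  exact: (fring_mx_nat FR).
exists (cramer_stress f g q (map_mx (fun k => k%:R) v)); split.
  rewrite mulmxBl -scalemxAl -(mulmxA _ (rowsub _ _)) mul_rowsub_mx mul1mx.
  rewrite -!(mulmxA (map_mx _ v)) scalemxAr (mulmxA (map_mx _ v)).
  by rewrite cramer_rank // !mulmxA subrr.
move=> k; have /prodf_neq0/(_ k isT) := Fqv.
exact: minor_rank.
Qed.

Hypothesis E_simple : simple_graph E.

(** The rigidity matrix is linear in the framework: on a basis vector [v], symmetry turns R(x) v
    into R(v) x. *)
Lemma rig_mx_line p u t :
  rig_mx T E (fun i => p i + t *: u i) = rig_mx T E p + t *: rig_mx T E u.
Proof.
apply/trmx_inj/row_matrixP => i; rewrite -!tr_col; congr trmx.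
rewrite !colE.
have [v ->] : exists v, delta_mx i 0 = (frame_vec (R := R) v)^T.
  exists (fun j => row j (vec_mx (delta_mx 0 i))).
  by rewrite frame_vec_surj trmx_delta.
rewrite mulmxDl -scalemxAl !(rig_mx_sym T E_simple _ v) scalemxAr -mulmxDr.
rewrite -linearZ -linearD /= -linearZ -linearD /=.
congr (_ *m (mxvec _)^T).
by apply/matrixP => j k; rewrite !mxE.
Qed.

(* For v(t) in the kernel of the rigidity matrix R(q + t x), with v(t)
   polynomial in t and v(0) proportional to u, one has t (w R(x) v(t)) = 0, hence
   w R(x) u = w R(u) x = 0 for every direction x. *)
Lemma generic_stress_kills_motions q u w :
  generic_frame q -> w *m rig_mx T E q = 0 -> motion T E q u ->
  w *m rig_mx T E u = 0.
Proof.
move=> gq wq /(motionP _ E_simple) uq.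
have [f [g detq]] := exists_minor (rig_mx T E q).
pose M (x : 'I_n -> 'rV[R]_3) := mxsub f g (rig_mx T E x).
have FR := @frame_function_ring R n.
(* The identity holds at [q] by the choice of the minor. Its entries are frame functions, so
   genericity spreads it to every framework, in particular along the line q + t x. *)
have cramer x : \det (M x) *: rig_mx T E x =
    colsub g (rig_mx T E x) *m \adj (M x) *m rowsub f (rig_mx T E x).
  apply/eqP; rewrite -subr_eq0; apply/eqP/matrixP => i j; rewrite [RHS]mxE.
  pose D (x : 'I_n -> 'rV[R]_3) := \det (M x) *: rig_mx T E x -
    colsub g (rig_mx T E x) *m \adj (M x) *m rowsub f (rig_mx T E x).
  apply: (gq (fun x => D x i j)); last by rewrite /D cramer_rank // subrr mxE.
  have FA := frame_function_rig_mx.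
  have FM : fring_mx (@frame_function R n) M by apply: (fring_mx_mxsub FR).
  apply: (fring_mx_sub FR).
    by apply: (fring_mx_scale FR) => //; apply: (fring_det FR).
  apply: (fring_mx_mul FR); last exact: (fring_mx_mxsub FR).
  apply: (fring_mx_mul FR); first exact: (fring_mx_mxsub FR).
  exact: (fring_mx_adj FR).
suff wR x : w *m rig_mx T E x *m (frame_vec u)^T = 0.
  rewrite -[LHS]mulmx1; apply/trmx_inj/row_matrixP => i; rewrite -!tr_col; congr trmx.
  rewrite col0 colE mulmx1.
  have [v ->] : exists v, delta_mx i 0 = (frame_vec (R := R) v)^T.
    exists (fun j => row j (vec_mx (delta_mx 0 i))).
    by rewrite frame_vec_surj trmx_delta.
  by rewrite -mulmxA (rig_mx_sym T E_simple) mulmxA.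
pose X t := rig_mx T E q + t *: rig_mx T E x.
have XE t : X t = rig_mx T E (fun i => q i + t *: x i) by rewrite rig_mx_line.
pose V t := \det (mxsub f g (X t)) *: (frame_vec u)^T -
  colsub g 1%:M *m \adj (mxsub f g (X t)) *m rowsub f (X t) *m (frame_vec u)^T.
have XV t : X t *m V t = 0.
  rewrite mulmxBr -scalemxAr scalemxAl !mulmxA mulmx_colsub mulmx1.
  by rewrite XE -/(M _) cramer subrr.
have V0 : V 0 = \det (M q) *: (frame_vec u)^T.
  rewrite /V /X scale0r addr0 -!mulmxA mul_rowsub_mx uq linear0 !mulmx0 subr0.
  by [].
suff : w *m rig_mx T E x *m V 0 = 0.
  by rewrite V0 -scalemxAr => /eqP; rewrite scaler_eq0 (negPf detq) => /eqP.
apply/matrixP => i j; rewrite [RHS]mxE.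
have PR := @poly_function_ring R.
have PC m1 m2 (A : 'M[R]_(m1, m2)) : fring_mx (@poly_function R) (fun=> A).
  by move=> a b; apply: poly_function_const.
apply: (poly_function_extend0 (f := fun t => (w *m rig_mx T E x *m V t) i j)).
  apply: (fring_mx_mul PR) => //.
  have PX : fring_mx (@poly_function R) X.
    move=> a b; apply: (fring_ext PR) (fun t => rig_mx T E q a b + t * rig_mx T E x a b) _ _ _.
      by move=> t; rewrite [RHS]mxE [X in _ = _ + X]mxE.
    apply: (fring_add PR); first exact: poly_function_const.
    by apply: (fring_mul PR); [apply: poly_function_id | apply: poly_function_const].
  have PM := fring_mx_mxsub PR f g PX.
  apply: (fring_mx_sub PR).
    by apply: (fring_mx_scale PR) => //; apply: (fring_det PR).
  apply: (fring_mx_mul PR) => //.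
  apply: (fring_mx_mul PR); last exact: (fring_mx_mxsub PR).
  by apply: (fring_mx_mul PR) => //; apply: (fring_mx_adj PR).
move=> t t0.
have /eqP : t *: (w *m rig_mx T E x *m V t) = 0.
  have := congr1 (mulmx w) (XV t).
  by rewrite mulmx0 mulmxA [w *m X t]mulmxDr wq add0r -scalemxAr -scalemxAl.
by rewrite scaler_eq0 (negPf t0) => /eqP ->; rewrite mxE.
Qed.

End GenericFrameworks.

(** * Space coordinates, kernels of small dimension and 3 by 3 systems *)

Notation cx := (@Ordinal 3 0 isT).
Notation cy := (@Ordinal 3 1 isT).
Notation cz := (@Ordinal 3 2 isT).

Lemma big_ord3 (V : nmodType) (F : 'I_3 -> V) :
  \sum_(k < 3) F k = F cx + F cy + F cz.
Proof.
rewrite !big_ord_recl big_ord0 addr0 addrA.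
by congr (F _ + F _ + F _); apply: val_inj.
Qed.

Lemma ord3_ind (Q : 'I_3 -> Prop) : Q cx -> Q cy -> Q cz -> forall k, Q k.
Proof.
move=> Qx Qy Qz [[|[|[|//]]] ltk].
- by rewrite (_ : Ordinal ltk = cx) //; apply: val_inj.
- by rewrite (_ : Ordinal ltk = cy) //; apply: val_inj.
- by rewrite (_ : Ordinal ltk = cz) //; apply: val_inj.
Qed.

Section LinearAlgebra.
Variable F : fieldType.

(** Rank-nullity: a nonzero kernel vector caps the rank, and at the cap it spans the kernel.
    Coordinate [a] certifies that [x] is nonzero. *)
Lemma corank1 m n (A : 'M[F]_(m, n)) (x : 'cV_n) a :
  x a 0 != 0 -> A *m x = 0 ->
  (\rank A + 1 <= n)%N /\
  ((n <= \rank A + 1)%N ->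
   forall v : 'cV_n, A *m v = 0 -> exists s, v = s *: x).
Proof.
move=> xa Ax.
have rx : \rank x^T = 1%N.
  apply/eqP; apply: inj_row_free => v; rewrite [v]mx11_scalar mul_scalar_mx.
  move/rowP/(_ a); rewrite !mxE => /eqP.
  by rewrite mulf_eq0 (negPf xa) orbF => /eqP ->; rewrite raddf0.
have sxK : (x^T <= kermx A^T)%MS.
  by apply/sub_kermxP; rewrite -trmx_mul Ax trmx0.
split; first by rewrite -[X in (_ + X)%N]rx mxrank_tr mulmx0_rank_max.
move=> rkA v Av.
have sKx : (kermx A^T <= x^T)%MS.
  rewrite -(geq_leqif (mxrank_leqif_sup sxK)) mxrank_ker rx mxrank_tr.
  by rewrite leq_subLR.
have : (v^T <= x^T)%MS.
  by apply: submx_trans sKx; apply/sub_kermxP; rewrite -trmx_mul Av trmx0.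
case/submxP => c /(congr1 trmx); rewrite trmx_mul !trmxK [c]mx11_scalar.
by rewrite tr_scalar_mx mul_mx_scalar => ->; exists (c 0 0).
Qed.

(** The two-dimensional analogue of [corank1]; the minor in rows [a] and [b] certifies that [x] and
    [y] are independent. *)
Lemma corank2 m n (A : 'M[F]_(m, n)) (x y : 'cV_n) a b :
  x a 0 * y b 0 - x b 0 * y a 0 != 0 -> A *m x = 0 -> A *m y = 0 ->
  (\rank A + 2 <= n)%N /\
  ((n <= \rank A + 2)%N ->
   forall v : 'cV_n, A *m v = 0 -> exists s t, v = s *: x + t *: y).
Proof.
move=> xy Ax Ay; pose K := col_mx x^T y^T.
have rK : \rank K = 2%N.
  apply/eqP; apply: (@inj_row_free _ (1 + 1) n) => v; rewrite -[v]hsubmxK.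
  rewrite mul_row_col [lsubmx v]mx11_scalar [rsubmx v]mx11_scalar !mul_scalar_mx.
  set s := lsubmx v 0 0; set t := rsubmx v 0 0 => /rowP st0.
  have := st0 a; have := st0 b; rewrite !mxE => ea eb.
  have s0 : s = 0.
    apply/eqP; rewrite -(mulIr_eq0 s (mulIf xy)); apply/eqP.
    transitivity ((s * x a 0 + t * y a 0) * y b 0 - (s * x b 0 + t * y b 0) * y a 0).
      by ring.
    by rewrite ea eb; ring.
  have t0 : t = 0.
    apply/eqP; rewrite -(mulIr_eq0 t (mulIf xy)); apply/eqP.
    transitivity ((s * x b 0 + t * y b 0) * x a 0 - (s * x a 0 + t * y a 0) * x b 0).
      by ring.
    by rewrite ea eb; ring.
  by rewrite s0 t0 !raddf0 row_mx0.
have KA0 : A *m K^T = 0 by rewrite tr_col_mx !trmxK mul_mx_row Ax Ay row_mx0.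
have sxK : (K <= kermx A^T)%MS.
  by apply/sub_kermxP; rewrite -[K]trmxK -trmx_mul KA0 trmx0.
split; first by rewrite -[X in (_ + X)%N]rK -(mxrank_tr K) mulmx0_rank_max.
move=> rkA v Av.
have sKx : (kermx A^T <= K)%MS.
  rewrite -(geq_leqif (mxrank_leqif_sup sxK)) mxrank_ker rK mxrank_tr.
  by rewrite leq_subLR.
have : (v^T <= K)%MS.
  by apply: submx_trans sKx; apply/sub_kermxP; rewrite -trmx_mul Av trmx0.
case/submxP => c; rewrite -[c]hsubmxK mul_row_col.
rewrite [lsubmx c]mx11_scalar [rsubmx c]mx11_scalar !mul_scalar_mx.
move/(congr1 trmx); rewrite linearD !linearZ /= !trmxK => ->.
by exists (lsubmx c 0 0), (rsubmx c 0 0).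
Qed.

Lemma rank_kernel_bound m n l (A : 'M[F]_(m, n)) (K : 'M_(l, n)) :
  (forall u : 'rV_n, A *m u^T = 0 -> (u <= K)%MS) -> (n <= \rank A + l)%N.
Proof.
move=> AK; have /mxrankS : (kermx A^T <= K)%MS.
  apply/row_subP => i; apply: AK; apply/trmx_inj.
  by rewrite trmx_mul trmxK trmx0 -row_mul mulmx_ker row0.
rewrite mxrank_ker mxrank_tr => rkK.
by rewrite -leq_subLR (leq_trans rkK) // rank_leq_row.
Qed.

(** The determinant is expanded, with its rows listed in turn, so that [ring] and the closure lemmas
    apply directly. *)
Definition det3 (a1 b1 c1 a2 b2 c2 a3 b3 c3 : F) :=
  a1 * (b2 * c3 - b3 * c2) - b1 * (a2 * c3 - a3 * c2) + c1 * (a2 * b3 - a3 * b2).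

Lemma det3_solve (a1 b1 c1 a2 b2 c2 a3 b3 c3 r s t : F) :
  det3 a1 b1 c1 a2 b2 c2 a3 b3 c3 != 0 ->
  r * a1 + s * b1 + t * c1 = 0 -> r * a2 + s * b2 + t * c2 = 0 ->
  r * a3 + s * b3 + t * c3 = 0 -> [/\ r = 0, s = 0 & t = 0].
Proof.
set D := det3 _ _ _ _ _ _ _ _ _ => D0 e1 e2 e3.
have zero x y : x * D = y -> y = 0 -> x = 0.
  by move=> <- /eqP; rewrite mulf_eq0 (negPf D0) orbF => /eqP.
split.
(* Each unknown times [D] is the combination of the three equations with the cofactors of its
   column. *)
- apply: (zero _ ((r * a1 + s * b1 + t * c1) * (b2 * c3 - b3 * c2)
    - (r * a2 + s * b2 + t * c2) * (b1 * c3 - b3 * c1)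
    + (r * a3 + s * b3 + t * c3) * (b1 * c2 - b2 * c1))).
    by rewrite /D /det3; ring.
  by rewrite e1 e2 e3; ring.
- apply: (zero _ (- (r * a1 + s * b1 + t * c1) * (a2 * c3 - a3 * c2)
    + (r * a2 + s * b2 + t * c2) * (a1 * c3 - a3 * c1)
    - (r * a3 + s * b3 + t * c3) * (a1 * c2 - a2 * c1))).
    by rewrite /D /det3; ring.
  by rewrite e1 e2 e3; ring.
- apply: (zero _ ((r * a1 + s * b1 + t * c1) * (a2 * b3 - a3 * b2)
    - (r * a2 + s * b2 + t * c2) * (a1 * b3 - a3 * b1)
    + (r * a3 + s * b3 + t * c3) * (a1 * b2 - a2 * b1))).
    by rewrite /D /det3; ring.
  by rewrite e1 e2 e3; ring.
Qed.

End LinearAlgebra.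

(** * Polynomial conditions satisfied by generic frameworks *)

Ltac frame_fun FR :=
  repeat first
    [ exact: frame_function_coord | apply: (fring_nat FR) | apply: (fring_rat FR)
    | apply: (fring_surface_coef FR)
    | apply: (fring_add FR) | apply: (fring_opp FR) | apply: (fring_mul FR)
    | apply: (fring_exp FR) ].

Section NonDegeneracy.
Variables (R : realType) (n : nat) (q : 'I_n -> 'rV[R]_3).
Hypothesis gq : generic_frame q.
Let FR := @frame_function_ring R n.

Definition row3 (x y z : R) : 'rV[R]_3 := \row_k [:: x; y; z]`_k.

(** Here and in the next lemmas, the explicit framework [p] witnesses that the polynomial is not
    identically zero. *)
Lemma generic_coord a k : q a 0 k != 0.
Proof.
apply: (generic_frame_neq0 (f := fun p => p a 0 k) (p := fun=> const_mx 1) gq).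
  exact: frame_function_coord.
by rewrite !mxE oner_eq0.
Qed.

Lemma generic_xy a b : a != b -> q a 0 cx * q b 0 cy - q b 0 cx * q a 0 cy != 0.
Proof.
move=> nab.
apply: (generic_frame_neq0 (f := fun p => p a 0 cx * p b 0 cy - p b 0 cx * p a 0 cy)
  (p := fun i => if i == a then row3 1 0 0 else row3 0 1 0) gq).
  by frame_fun FR.
rewrite eqxx [b == a]eq_sym (negPf nab) !mxE /=.
by rewrite mulr1 mulr0 subr0 oner_eq0.
Qed.

Lemma generic_z a b : a != b -> q b 0 cz - q a 0 cz != 0.
Proof.
move=> nab; apply: (generic_frame_neq0 (f := fun p => p b 0 cz - p a 0 cz)
  (p := fun i => if i == a then row3 0 0 0 else row3 0 0 1) gq).
  by frame_fun FR.
by rewrite eqxx [b == a]eq_sym (negPf nab) !mxE /= subr0 oner_eq0.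
Qed.

Variables a b c : 'I_n.
Hypotheses (nab : a != b) (nca : c != a) (ncb : c != b).

(** No nonzero diagonal quadratic form vanishes at all three points; the witness puts them on the
    three axes. *)
Lemma generic_squares :
  det3 (q a 0 cx ^+ 2) (q a 0 cy ^+ 2) (q a 0 cz ^+ 2)
       (q b 0 cx ^+ 2) (q b 0 cy ^+ 2) (q b 0 cz ^+ 2)
       (q c 0 cx ^+ 2) (q c 0 cy ^+ 2) (q c 0 cz ^+ 2) != 0.
Proof.
apply: (generic_frame_neq0 (f := fun q =>
  det3 (q a 0 cx ^+ 2) (q a 0 cy ^+ 2) (q a 0 cz ^+ 2)
       (q b 0 cx ^+ 2) (q b 0 cy ^+ 2) (q b 0 cz ^+ 2)
       (q c 0 cx ^+ 2) (q c 0 cy ^+ 2) (q c 0 cz ^+ 2))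
  (p := fun i => if i == a then row3 1 0 0 else
                 if i == b then row3 0 1 0 else row3 0 0 1) gq).
  by rewrite /det3; frame_fun FR.
rewrite !eqxx [b == a]eq_sym (negPf nab) (negPf nca) (negPf ncb) /det3 !mxE /=.
have neq0 (x : R) : x = 1 -> x != 0 by move=> ->; apply: oner_neq0.
by apply: neq0; ring.
Qed.

(** The rows evaluate x^2, xy and y^2: no nonzero binary quadratic form vanishes at the projections
    of all three points to the xy-plane. *)
Lemma generic_conic :
  det3 (q a 0 cx ^+ 2) (q a 0 cx * q a 0 cy) (q a 0 cy ^+ 2)
       (q b 0 cx ^+ 2) (q b 0 cx * q b 0 cy) (q b 0 cy ^+ 2)
       (q c 0 cx ^+ 2) (q c 0 cx * q c 0 cy) (q c 0 cy ^+ 2) != 0.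
Proof.
apply: (generic_frame_neq0 (f := fun q =>
  det3 (q a 0 cx ^+ 2) (q a 0 cx * q a 0 cy) (q a 0 cy ^+ 2)
       (q b 0 cx ^+ 2) (q b 0 cx * q b 0 cy) (q b 0 cy ^+ 2)
       (q c 0 cx ^+ 2) (q c 0 cx * q c 0 cy) (q c 0 cy ^+ 2))
  (p := fun i => if i == a then row3 1 0 0 else
                 if i == b then row3 1 1 0 else row3 0 1 0) gq).
  by rewrite /det3; frame_fun FR.
rewrite !eqxx [b == a]eq_sym (negPf nab) (negPf nca) (negPf ncb) /det3 !mxE /=.
have neq0 (x : R) : x = 1 -> x != 0 by move=> ->; apply: oner_neq0.
by apply: neq0; ring.
Qed.

(* The normal of the surface through the midpoint of ab is transverse to the
   plane through a, b and c. *)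
Lemma generic_midpoint T :
  let m k := (q a 0 k + q b 0 k) / 2 in
  det3 (m cx - q a 0 cx) (m cy - q a 0 cy) (m cz - q a 0 cz)
       (m cx - q c 0 cx) (m cy - q c 0 cy) (m cz - q c 0 cz)
       (surface_coef R T cx * m cx) (surface_coef R T cy * m cy)
       (surface_coef R T cz * m cz) != 0.
Proof.
move=> /=; apply: (generic_frame_neq0 (f := fun q =>
  let m k := (q a 0 k + q b 0 k) / 2 in
  det3 (m cx - q a 0 cx) (m cy - q a 0 cy) (m cz - q a 0 cz)
       (m cx - q c 0 cx) (m cy - q c 0 cy) (m cz - q c 0 cz)
       (surface_coef R T cx * m cx) (surface_coef R T cy * m cy)
       (surface_coef R T cz * m cz))
  (* The midpoint of this witness is (1, 0, 0), and the normal there is (1, 0, 0) for both types. *)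
  (p := fun i => if i == a then row3 1 1 0 else
                 if i == b then row3 1 (-1) 0 else row3 1 0 1) gq).
  have half : frame_function (fun _ : 'I_n -> 'rV[R]_3 => 2^-1).
    apply: (fring_ext FR) (fring_rat FR 2^-1) => z.
    by rewrite fmorphV rmorph_nat.
  by rewrite /det3 /=; frame_fun FR; try exact: half.
rewrite /= !eqxx [b == a]eq_sym (negPf nab) (negPf nca) (negPf ncb) /det3 !mxE /=.
have -> : surface_coef R T cx = 1 by case: T.
have neq0 (x : R) : x = 1 -> x != 0 by move=> ->; apply: oner_neq0.
by apply: neq0; field.
Qed.

End NonDegeneracy.

(** * Trivial motions *)

(** Cylinders admit rotation about the z-axis, at rate [s], and translation along it, at rate [t];
    ellipsoids admit only 0. The number of parameters is [surface_ell]. *)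
Definition trivial_motion (R : realType) (T : surface_type) n
    (p u : 'I_n -> 'rV[R]_3) : Prop :=
  match T with
  | Cylinders => exists s t, forall i,
      [/\ u i 0 cx = s * p i 0 cy, u i 0 cy = - s * p i 0 cx & u i 0 cz = t]
  | Ellipsoids _ _ => forall i k, u i 0 k = 0
  end.

Definition proper_surface (T : surface_type) : bool :=
  if T is Ellipsoids alpha beta then (0 < alpha) && (0 < beta) else true.

Section TrivialMotions.
Variables (R : realType) (T : surface_type) (n : nat) (E : {set {set 'I_n}}).
Implicit Types (p q u : 'I_n -> 'rV[R]_3).

Lemma trivial_motion_is_motion p u : trivial_motion T p u -> motion T E p u.
Proof.
case: T => [|alpha beta] /= u_triv; last first.
  split=> [i j _ _|i]; first by apply: big1 => k _; rewrite !u_triv subr0 mulr0.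
  by apply: big1 => k _; rewrite u_triv mulr0.
have [s [t st]] := u_triv.
split=> [i j _ _|i]; rewrite /edge_form /surf_form big_ord3 /=.
  by have [-> -> ->] := st i; have [-> -> ->] := st j; ring.
by have [-> -> ->] := st i; ring.
Qed.

Hypothesis E_simple : simple_graph E.

Lemma rig_mx_rank_ge p :
  (forall u, motion T E p u -> trivial_motion T p u) ->
  (3 * n <= \rank (rig_mx T E p) + surface_ell T)%N.
Proof.
move=> rig; rewrite (mulnC 3).
have {}rig (v : 'rV_(n * 3)) : rig_mx T E p *m v^T = 0 ->
    exists2 u, trivial_motion T p u & v = frame_vec u.
  rewrite -{1}[v]frame_vec_surj => /(motionP _ E_simple)/rig uT.
  by exists (fun i => row i (vec_mx v)); rewrite ?frame_vec_surj.
case: T rig => [|alpha beta] rig.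
  pose rot i := row3 (p i 0 cy) (- p i 0 cx) 0; pose tr (_ : 'I_n) : 'rV[R]_3 := row3 0 0 1.
  apply: (@rank_kernel_bound _ _ _ (1 + 1) _ (col_mx (frame_vec rot) (frame_vec tr))).
  move=> v /rig [u [s [t st]] ->].
  apply/submxP; exists (row_mx s%:M t%:M).
  rewrite mul_row_col !mul_scalar_mx -!linearZ -linearD /=; congr mxvec.
  apply/matrixP => i; apply: ord3_ind; have [ux uy uz] := st i;
    rewrite !mxE /= ?ux ?uy ?uz; ring.
apply: (@rank_kernel_bound _ _ _ 0 _ 0) => v /rig [u /= uT ->].
rewrite (_ : frame_vec u = 0) ?sub0mx //; apply: (can_inj vec_mxK).
by rewrite mxvecK raddf0; apply/matrixP => i k; rewrite !mxE uT.
Qed.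

(** For cylinders, rotation and translation are independent kernel vectors: their minor at the y-
    and z-coordinates of vertex [i] is minus the x-coordinate of p_i. *)
Lemma rig_mx_rank_le p i : p i 0 cx != 0 ->
  (\rank (rig_mx T E p) + surface_ell T <= 3 * n)%N.
Proof.
move=> px; rewrite (mulnC 3); have := @trivial_motion_is_motion p.
case: T => [|alpha beta] triv /=; last by rewrite addn0 rank_leq_col.
pose rot i := row3 (p i 0 cy) (- p i 0 cx) 0; pose tr (_ : 'I_n) : 'rV[R]_3 := row3 0 0 1.
apply: (corank2 (x := (frame_vec rot)^T) (y := (frame_vec tr)^T)
  (a := mxvec_index i cy) (b := mxvec_index i cz) _ _ _).1.
- rewrite ![_^T _ _]mxE /frame_vec !mxvecE !mxE /=.
  by rewrite mul0r subr0 mulr1 oppr_eq0.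
- apply/(motionP _ E_simple)/triv; exists 1, 0 => j.
  by rewrite !mxE /=; split; ring.
- apply/(motionP _ E_simple)/triv; exists 0, 1 => j.
  by rewrite !mxE /=; split; ring.
Qed.

Variables (q : 'I_n -> 'rV[R]_3) (om : {set 'I_n} -> R) (la : 'I_n -> R).
Hypotheses (gq : generic_frame q)
  (stress_q : stress_vec E om la *m rig_mx T E q = 0).
Variables a b : 'I_n.
Hypothesis nab : a != b.

(** For cylinders the x and y blocks coincide, so both kernels contain both coordinate vectors,
    while the z block is Omega, which also kills constants. For ellipsoids only the block's own
    coordinate vector is available. *)
Definition kernel_shape k (v : 'cV[R]_n) : Prop :=
  match T with
  | Cylinders => exists s t, forall i,
      v i 0 = if k == cz then s + t * q i 0 cz else s * q i 0 cx + t * q i 0 cy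
  | Ellipsoids _ _ => exists s, forall i, v i 0 = s * q i 0 k
  end.

(** The expected corank of one block, a third of [surface_mu]. *)
Let mu3 := if T is Cylinders then 2%N else 1%N.

Lemma stress_block_kernel k :
  (\rank (stress_block T E om la k) + mu3 <= n)%N /\
  ((n <= \rank (stress_block T E om la k) + mu3)%N ->
   forall v : 'cV_n, stress_block T E om la k *m v = 0 -> kernel_shape k v).
Proof.
have /(equilibriumP _ E_simple) := stress_q; rewrite {}/mu3 /kernel_shape.
case: T => [|alpha beta] st; last first.
  have qa : coord_col q k a 0 != 0 by rewrite mxE generic_coord.
  have [rk ker] := corank1 qa (st k); split=> // /ker {}ker v /ker [s ->].
  by exists s => i; rewrite !mxE.
have xy1 : stress_block Cylinders E om la cx = stress_block Cylinders E om la cy.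
  by [].
have xy : coord_col q cx a 0 * coord_col q cy b 0 -
          coord_col q cx b 0 * coord_col q cy a 0 != 0.
  by rewrite !mxE generic_xy.
have [kz|nkz] := eqVneq k cz.
  have one_z : (const_mx 1 : 'cV[R]_n) a 0 * coord_col q cz b 0 -
               (const_mx 1 : 'cV[R]_n) b 0 * coord_col q cz a 0 != 0.
    by rewrite !mxE !mul1r generic_z.
  have Om1 : stress_block Cylinders E om la cz *m (const_mx 1 : 'cV[R]_n) = 0.
    rewrite /stress_block /= scale0r addr0; apply/colP => i; rewrite [RHS]mxE.
    have := Omega_mx_mul E_simple om (fun=> const_mx 1) i cz.
    rewrite (_ : coord_col _ cz = const_mx 1); last by apply/colP => j; rewrite !mxE.
    by move=> ->; apply: big1 => j _; rewrite !mxE subrr mulr0.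
  have [rk ker] := corank2 one_z Om1 (st cz).
  rewrite kz; split=> // /ker {}ker v /ker [s [t ->]].
  by exists s, t => i; rewrite !mxE mulr1.
have -> : stress_block Cylinders E om la k = stress_block Cylinders E om la cx.
  by move: nkz; elim/ord3_ind: k.
have [rk ker] : _ /\ _ := corank2 xy (st cx) (etrans (congr1 (mulmx^~ _) xy1) (st cy)).
split=> // /ker {}ker v /ker [s [t ->]].
by exists s, t => i; rewrite !mxE.
Qed.

Lemma stress_rank_le :
  (\sum_(k < 3) \rank (stress_block T E om la k) + surface_mu T <= 3 * n)%N.
Proof.
rewrite big_ord3 /=.
have [rx _] := stress_block_kernel cx; have [ry _] := stress_block_kernel cy.
have [rz _] := stress_block_kernel cz; rewrite /mu3 in rx ry rz.
by case: T rx ry rz => [|al be] /= *; lia.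
Qed.

Variable c : 'I_n.
Hypotheses (nca : c != a) (ncb : c != b).

Hypothesis stress_max :
  (3 * n <= \sum_(k < 3) \rank (stress_block T E om la k) + surface_mu T)%N.

(** No block exceeds rank n - [mu3], so a maximal total forces equality in each block. *)
Lemma stress_block_rank k : (n <= \rank (stress_block T E om la k) + mu3)%N.
Proof.
move: stress_max; rewrite big_ord3 /=.
have [rx _] := stress_block_kernel cx; have [ry _] := stress_block_kernel cy.
have [rz _] := stress_block_kernel cz; rewrite /mu3 in rx ry rz *.
by case: T rx ry rz => [|al be] /= *; elim/ord3_ind: k; lia.
Qed.

Hypothesis T_proper : proper_surface T.

(** The stress annihilates [u], so each coordinate vector of [u] has the form [kernel_shape].
    Tangency to the surfaces at [a], [b], [c] then says that a quadratic form in the coefficients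
    vanishes at three generic points, so that form is zero. *)
Lemma generic_motion_trivial u : motion T E q u -> trivial_motion T q u.
Proof.
move=> mu; have := generic_stress_kills_motions E_simple gq stress_q mu.
have [edge_u surf_u] := mu.
move=> /(equilibriumP _ E_simple) ker.
have {}ker k : kernel_shape k (coord_col u k).
  have [_ shape] := stress_block_kernel k.
  exact: shape (stress_block_rank k) _ (ker k).
move: ker surf_u edge_u T_proper (stress_block_rank cz); rewrite /kernel_shape {}/mu3.
case: T => [|alpha beta] ker surf_u edge_u /=; last first.
  move=> /andP[al be] _.
  have := ker cx; have := ker cy; have := ker cz.
  move=> [sz uz] [sy uy] [sx ux].
  have {}uz i : u i 0 cz = sz * q i 0 cz by have := uz i; rewrite mxE.
  have {}uy i : u i 0 cy = sy * q i 0 cy by have := uy i; rewrite mxE.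
  have {}ux i : u i 0 cx = sx * q i 0 cx by have := ux i; rewrite mxE.
  have eq0 i : sx * q i 0 cx ^+ 2 + (ratr alpha * sy) * q i 0 cy ^+ 2 +
      (ratr beta * sz) * q i 0 cz ^+ 2 = 0.
    have := surf_u i; rewrite /surf_form big_ord3 /= ux uy uz => <-; ring.
  have [sx0 sy0 sz0] := det3_solve (generic_squares gq nab nca ncb) (eq0 a) (eq0 b) (eq0 c).
  have al0 : ratr alpha != 0 :> R by rewrite fmorph_eq0 gt_eqF.
  have be0 : ratr beta != 0 :> R by rewrite fmorph_eq0 gt_eqF.
  move/eqP: sy0; rewrite mulf_eq0 (negPf al0) /= => /eqP sy0.
  move/eqP: sz0; rewrite mulf_eq0 (negPf be0) /= => /eqP sz0.
  by move=> i; apply: ord3_ind; rewrite ?ux ?uy ?uz ?sx0 ?sy0 ?sz0 mul0r.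
move=> _ rkz.
have [sz [tz uz]] := ker cz; have [sy [ty uy]] := ker cy; have [sx [tx ux]] := ker cx.
have {}uz i : u i 0 cz = sz + tz * q i 0 cz by have := uz i; rewrite mxE.
have {}uy i : u i 0 cy = sy * q i 0 cx + ty * q i 0 cy by have := uy i; rewrite mxE.
have {}ux i : u i 0 cx = sx * q i 0 cx + tx * q i 0 cy by have := ux i; rewrite mxE.
have eq0 i : sx * q i 0 cx ^+ 2 + (tx + sy) * (q i 0 cx * q i 0 cy) +
    ty * q i 0 cy ^+ 2 = 0.
  have := surf_u i; rewrite /surf_form big_ord3 /= ux uy uz => <-; ring.
have [sx0 txy ty0] := det3_solve (generic_conic gq nab nca ncb) (eq0 a) (eq0 b) (eq0 c).
have sy0 : sy = - tx by rewrite -[sy](addKr tx) txy addr0.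
(* Only a stretch along the axis is left. It changes the length of an edge at a rate proportional to
   [tz] times a nonzero square. An edge exists, since otherwise the z block would be 0, of corank n
   > 2. *)
have tz0 : tz = 0.
  have n3 : (2 < n)%N.
    rewrite -[n]card_ord (leq_trans _ (max_card [set a; b; c])) //.
    by rewrite setUC cardsU1 !inE negb_or nca ncb cards2 nab.
  have [E0|[e eE]] := set_0Vmem E.
    have : stress_block Cylinders E om la cz = 0.
      rewrite /stress_block /= scale0r addr0 E0; apply/matrixP => i j.
      rewrite !mxE; case: ifP => _; last by rewrite /stress_weight inE oppr0.
      by apply: big1 => l _; rewrite /stress_weight inE.
    by move=> B0; move: rkz; rewrite B0 mxrank0; lia.
  have [i [j [nij eij]]] := edge_cases E_simple eE.
  have zij := generic_z gq nij.
  rewrite eij in eE; have := edge_u i j nij eE.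
  rewrite /edge_form big_ord3 /= !ux !uy !uz sx0 ty0 sy0 => h.
  have : tz * (q j 0 cz - q i 0 cz) ^+ 2 = 0 by rewrite -h; ring.
  by move/eqP; rewrite mulf_eq0 sqrf_eq0 (negPf zij) orbF => /eqP.
exists tx, sz => i; rewrite ux uy uz sx0 ty0 tz0 sy0.
by split; ring.
Qed.

End TrivialMotions.

(** * The extension at a midpoint *)

Lemma set2_eq (I : finType) (a b i j : I) : a != b ->
  ([set i; j] == [set a; b]) = ((i == a) && (j == b)) || ((i == b) && (j == a)).
Proof.
move=> nab; apply/eqP/orP => [/setP eqs|[] /andP[/eqP -> /eqP ->] //]; last first.
  by rewrite setUC.
have /set2P[ia|ib] : i \in [set a; b] by rewrite -eqs !inE eqxx.
  have : b \in [set i; j] by rewrite eqs !inE eqxx orbT.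
  by rewrite ia !inE eq_sym (negPf nab) eqxx eq_sym /= => ->; left.
have : a \in [set i; j] by rewrite eqs !inE eqxx.
by rewrite ib !inE (negPf nab) eqxx eq_sym /= => ->; right.
Qed.

Lemma sum_indicator (A : pzSemiRingType) (I : finType) (a : I) (F : I -> A) :
  \sum_i (i == a)%:R * F i = F a.
Proof.
rewrite (bigD1 a) //= eqxx mul1r big1 ?addr0 // => i /negPf ->.
by rewrite mul0r.
Qed.

Section OneExtension.
Variables (R : realType) (T : surface_type) (n : nat).
Variables (E : {set {set 'I_n}}) (E' : {set {set 'I_n.+1}}).
Variables a b c : 'I_n.
Hypotheses (E_simple : simple_graph E) (nab : a != b) (abE : [set a; b] \in E).
Hypotheses (nca : c != a) (ncb : c != b).
Hypothesis E'E : E' = [set lift ord0 @: (e : {set 'I_n}) | e in E :\ [set a; b]]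
  :|: [set [set ord0; lift ord0 a]; [set ord0; lift ord0 b]; [set ord0; lift ord0 c]].

Local Notation old := (lift (@ord0 n)).

Lemma imset_old2 i j : old @: [set i; j] = [set old i; old j].
Proof. by rewrite imsetU1 imset_set1. Qed.

Lemma extension_simple : simple_graph E'.
Proof.
move=> e; rewrite E'E !inE => /orP[/imsetP[e' + ->]|].
  by rewrite !inE => /andP[_ /E_simple]; rewrite card_imset //; apply: lift_inj.
by rewrite -orbA => /or3P[] /eqP ->; rewrite cards2 neq_lift.
Qed.

Lemma mem_extension_old i j :
  ([set old i; old j] \in E') = ([set i; j] != [set a; b]) && ([set i; j] \in E).
Proof.
rewrite E'E in_setU -imset_old2 mem_imset; last exact: imset_inj (@lift_inj _ _).
rewrite in_setD1 -[RHS]orbF; congr (_ || _).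
have no (d : 'I_n) : (old @: [set i; j] == [set ord0; old d]) = false.
  apply/negP => /eqP/setP/(_ ord0); rewrite imset_old2 !inE eqxx.
  by rewrite !(negPf (neq_lift _ _)).
by rewrite !inE !no.
Qed.

Lemma mem_extension_new j :
  ([set ord0; old j] \in E') = [|| j == a, j == b | j == c].
Proof.
rewrite E'E in_setU; rewrite [X in X || _](_ : _ = false) /=.
  have eq_new (d : 'I_n) : ([set ord0; old j] == [set ord0; old d]) = (j == d).
    by rewrite set2_eq ?neq_lift // eqxx (inj_eq (@lift_inj _ _)) (negPf (neq_lift _ _)) orbF.
  by rewrite !inE !eq_new orbA.
apply/negP => /imsetP[e _ /setP/(_ ord0)]; rewrite !inE eqxx => /esym/imsetP[i _ /eqP].
by rewrite (negPf (neq_lift _ _)).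
Qed.

(** [unlift ord0 i] is [None] exactly at the new vertex, so the default of [oapp] is the position of
    v_0. *)
Definition midpoint_frame (p : 'I_n -> 'rV[R]_3) (i : 'I_n.+1) : 'rV[R]_3 :=
  oapp p (2^-1 *: (p a + p b)) (unlift ord0 i).

Lemma midpoint_frame_old p i : midpoint_frame p (old i) = p i.
Proof. by rewrite /midpoint_frame liftK. Qed.

Lemma midpoint_frame_new p k :
  midpoint_frame p ord0 0 k = (p a 0 k + p b 0 k) / 2.
Proof. by rewrite /midpoint_frame unlift_none /= !mxE mulrC. Qed.

(** The restriction of [u] to the old vertices is a motion of the original framework, hence trivial.
    The velocity of v_0 is then determined by the edges to v_a and v_c and by its surface, as these
    three directions are independent by [generic_midpoint]. *)
Lemma midpoint_motion_trivial (p : 'I_n -> 'rV[R]_3) u :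
  generic_frame p -> (forall v, motion T E p v -> trivial_motion T p v) ->
  motion T E' (midpoint_frame p) u -> trivial_motion T (midpoint_frame p) u.
Proof.
move=> gp rig [edge_u surf_u]; set p' := midpoint_frame p in edge_u surf_u *.
have edge_new j : j \in [:: a; b; c] ->
    \sum_k (p' ord0 0 k - p j 0 k) * (u ord0 0 k - u (old j) 0 k) = 0.
  rewrite !inE -mem_extension_new => /edge_u; rewrite neq_lift => /(_ isT).
  by rewrite /edge_form /p' midpoint_frame_old.
(* The vectors from the midpoint to its two ends are opposite, so twice the sum of the two edge
   equations is the equation of the deleted edge. *)
have uab : edge_form p (fun i => u (old i)) a b = 0.
  have := edge_new a; have := edge_new b; rewrite !inE !eqxx !orbT => /(_ isT) eb /(_ isT) ea.
  rewrite /edge_form; move: ea eb; rewrite !big_ord3 !midpoint_frame_new => ea eb.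
  by have := congr2 (fun x y => 2 * (x + y)) ea eb; rewrite addr0 mulr0 => <-; field.
have triv : trivial_motion T p (fun i => u (old i)).
  apply: rig; split=> [i j nij ijE|i].
    have [/eqP|nij_ab] := eqVneq [set i; j] [set a; b].
      rewrite set2_eq // => /orP[] /andP[/eqP -> /eqP ->] //.
      by rewrite -uab; apply: eq_bigr => k _; ring.
    have := edge_u (old i) (old j); rewrite (inj_eq (@lift_inj _ _)) mem_extension_old.
    rewrite nij_ab ijE => /(_ nij isT); rewrite /edge_form /p'.
    by rewrite !midpoint_frame_old.
  by rewrite -(surf_u (old i)) /surf_form /p' midpoint_frame_old.
have D0 := generic_midpoint gp nab nca ncb T; rewrite /= -!midpoint_frame_new -/p' in D0.
have ea := edge_new a; have ec := edge_new c; have e0 := surf_u ord0.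
rewrite !inE !eqxx !orbT in ea ec; have {}ea := ea isT; have {}ec := ec isT.
rewrite /surf_form in e0; rewrite !big_ord3 in ea ec e0.
move: triv D0 ea ec e0; case: T => [|alpha beta] /= triv D0 ea ec e0; last first.
  have zero : [/\ u ord0 0 cx = 0, u ord0 0 cy = 0 & u ord0 0 cz = 0].
    apply: (det3_solve D0).
    - by rewrite -ea !triv; ring.
    - by rewrite -ec !triv; ring.
    - by rewrite -e0; ring.
  move=> i k; have [j ->|->] := unliftP ord0 i; first exact: triv.
  by have [? ? ?] := zero; elim/ord3_ind: k.
have [s [t st]] := triv; exists s, t.
(* The deviation of v_0 from the extended trivial motion solves a homogeneous system with nonzero
   determinant [D0]. *)
have zero : [/\ u ord0 0 cx - s * p' ord0 0 cy = 0,
    u ord0 0 cy + s * p' ord0 0 cx = 0 & u ord0 0 cz - t = 0].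
  apply: (det3_solve D0).
  - by rewrite -ea; have [-> -> ->] := st a; ring.
  - by rewrite -ec; have [-> -> ->] := st c; ring.
  - by apply: etrans e0; ring.
move=> i; have [j ->|->] := unliftP ord0 i.
  by rewrite /p' midpoint_frame_old; apply: st.
have [zx zy zz] := zero; split.
- by apply/eqP; rewrite -subr_eq0 zx.
- by apply/eqP; rewrite -subr_eq0 mulNr opprK zy.
- by apply/eqP; rewrite -subr_eq0 zz.
Qed.

Variables (om : {set 'I_n} -> R) (la : 'I_n -> R).

(** Both halves of v_a v_b carry doubled stress because they are half as long; v_0 v_c carries 0.
    The preimage recovers an old edge. *)
Definition extension_stress (e : {set 'I_n.+1}) : R :=
  if ord0 \in e then
    if (old a \in e) || (old b \in e) then 2 * om [set a; b] else 0
  else om (old @^-1: e).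

(** The value at v_0 is 0: the forces along the two halves cancel at the midpoint. *)
Definition extension_lambda (i : 'I_n.+1) : R := oapp la 0 (unlift ord0 i).

Let v : 'cV[R]_n := \col_i ((i == a)%:R + (i == b)%:R).
Let w := om [set a; b].

Lemma extension_weight_new j :
  stress_weight E' extension_stress ord0 (old j) = 2 * w * v j 0.
Proof.
rewrite /stress_weight mem_extension_new /extension_stress !inE eqxx /=.
rewrite !(inj_eq (@lift_inj _ _)) /= !mxE ![_ == j]eq_sym -/w.
have [->|nja] := eqVneq j a; first by rewrite (negPf nab) addr0 mulr1.
have [->|njb] := eqVneq j b; first by rewrite add0r mulr1.
by rewrite addr0 mulr0 if_same.
Qed.

Lemma extension_weight_old i j :
  stress_weight E' extension_stress (old i) (old j) =
  stress_weight E om i j - w * ([set i; j] == [set a; b])%:R.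
Proof.
rewrite /stress_weight mem_extension_old /extension_stress !inE.
rewrite !(negPf (neq_lift _ _)) /=.
have [->|nij] := eqVneq [set i; j] [set a; b]; first by rewrite abE mulr1 subrr.
rewrite mulr0 subr0 -imset_old2 (_ : old @^-1: (old @: [set i; j]) = [set i; j]) //.
by apply/setP => l; rewrite inE mem_imset //; apply: lift_inj.
Qed.

(** With e_a, e_b the unit vectors, deleting v_a v_b subtracts w (e_a - e_b)(e_a - e_b)^T from the
    old block and the new edges add 2w at its diagonal entries a and b; together this is w v v^T
    with v = e_a + e_b. *)
Lemma extension_stress_block k :
  stress_block T E' extension_stress extension_lambda k =
  block_mx (4 * w)%:M (- (2 * w) *: v^T) (- (2 * w) *: v)
           (stress_block T E om la k + w *: (v *m v^T)) :> 'M_(1 + n).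
Proof.
have indE i j : ([set i; j] == [set a; b])%:R =
    (i == a)%:R * (j == b)%:R + (i == b)%:R * (j == a)%:R :> R.
  rewrite set2_eq //; have [->|nia] := eqVneq i a.
    by rewrite (negPf nab) /= orbF; case: (j == b); ring.
  by case: (i == b); case: (j == a) => /=; ring.
have vE j : v j 0 = (j == a)%:R + (j == b)%:R by rewrite mxE.
have sum_v : \sum_j v j 0 = 2.
  under eq_bigr => j _ do rewrite mxE -[(j == a)%:R]mulr1 -[(j == b)%:R]mulr1.
  by rewrite big_split /= !(sum_indicator _ (fun=> 1)).
have loop i : stress_weight E' extension_stress i i = 0.
  by rewrite /stress_weight (negPf (loop_notin extension_simple i)).
apply/matrixP => i j; rewrite -[i](@splitK 1 n) -[j](@splitK 1 n).
have old_r (l : 'I_n) : rshift 1 l = old l by apply: val_inj.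
have new_l : lshift n (0 : 'I_1) = ord0 :> 'I_n.+1 by apply: val_inj.
case: (@split 1 n i) => {}i; case: (@split 1 n j) => {}j /=.
- rewrite block_mxEul !(ord1 i) !(ord1 j) !new_l !mxE !eqxx /=.
  rewrite /extension_lambda unlift_none mul0rn mulr0 addr0 big_ord_recl loop add0r.
  under eq_bigr => l _ do rewrite extension_weight_new.
  by rewrite -mulr_sumr sum_v mulr1n; ring.
- rewrite block_mxEur !(ord1 i) new_l old_r !mxE (negPf (neq_lift _ _)) mulr0n mulr0 addr0.
  by rewrite extension_weight_new mxE; ring.
- rewrite block_mxEdl !(ord1 j) new_l old_r !mxE eq_sym (negPf (neq_lift _ _)).
  by rewrite mulr0n mulr0 addr0 stress_weight_sym extension_weight_new mxE; ring.
rewrite block_mxEdr !old_r !mxE (inj_eq (@lift_inj _ _)) /extension_lambda liftK /=.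
rewrite big_ord1 !mxE addrAC; congr (_ + _).
case: eqVneq => [<-|nij].
  rewrite big_ord_recl stress_weight_sym extension_weight_new.
  rewrite (eq_bigr _ (fun l _ => extension_weight_old i l)).
  rewrite sumrB -mulr_sumr.
  have -> : \sum_l ([set i; l] == [set a; b])%:R = v i 0.
    under eq_bigr => l _ do rewrite indE.
    under eq_bigr => l _ do rewrite mulrC [X in _ + X]mulrC.
    by rewrite big_split /= !(sum_indicator _ (fun=> _%:R)) vE.
  rewrite vE addrCA; congr (_ + _).
  have [->|nia] := eqVneq i a; first by rewrite (negPf nab) /=; ring.
  by case: (i == b) => /=; ring.
rewrite extension_weight_old indE; have [ia|nia] := eqVneq i a.
  rewrite ia (negPf nab); move: nij; rewrite ia eq_sym => /negPf ->.
  by case: (j == b) => /=; ring.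
have [ib|nib] := eqVneq i b; last by rewrite /=; ring.
move: nij; rewrite ib eq_sym => /negPf ->.
by case: (j == a) => /=; ring.
Qed.

Let L : 'M[R]_(1 + n) := block_mx 1%:M 0 (- 2^-1 *: v) 1%:M.

(** Block elimination with pivot 4w and multiplier 2w/(4w) = 1/2. The Schur complement is the old
    block because (2w)^2/(4w) = w. *)
Lemma extension_stress_factor k :
  stress_block T E' extension_stress extension_lambda k =
  L *m block_mx (4 * w)%:M 0 0 (stress_block T E om la k) *m L^T :> 'M_(1 + n).
Proof.
rewrite extension_stress_block tr_block_mx !mulmx_block !trmx1 !trmx0.
rewrite !mul1mx !mulmx1 !mul0mx !mulmx0 !addr0 !add0r linearZ /= ?mul0mx ?mulmx0 ?add0r ?addr0.
rewrite mul_mx_scalar mul_scalar_mx !scalerA -scalemxAl -scalemxAr scalerA addrC.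
by congr (block_mx _ (_ *: _) (_ *: _) (_ *: _ + _)); field.
Qed.

Lemma extension_stress_rank k : w != 0 ->
  \rank (stress_block T E' extension_stress extension_lambda k) =
  (\rank (stress_block T E om la k)).+1.
Proof.
move=> w0; have LU : L \in unitmx by rewrite unitmxE det_lblock !det1 mulr1 unitr1.
rewrite extension_stress_factor mxrankMfree ?row_free_unit ?unitmx_tr //.
rewrite (eqmxMfull _ _) ?row_full_unit // rank_diag_block_mx -scalemx1.
by rewrite mxrank_scale_nz ?mxrank1 // mulf_neq0 // pnatr_eq0.
Qed.

(** [L^T] subtracts the mean of the entries at v_a and v_b from the entry at v_0. At the midpoint
    this leaves 0 above a kernel vector of the old block. *)
Lemma extension_equilibrium p :
  stress_vec E om la *m rig_mx T E p = 0 ->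
  stress_vec E' extension_stress extension_lambda
    *m rig_mx T E' (midpoint_frame p) = 0.
Proof.
move=> /(equilibriumP _ E_simple) st; apply/(equilibriumP _ extension_simple) => k.
rewrite extension_stress_factor.
have -> : coord_col (midpoint_frame p) k =
    col_mx ((p a 0 k + p b 0 k) / 2)%:M (coord_col p k) :> 'cV_(1 + n).
  apply/colP => i; rewrite -[i](@splitK 1 n) mxE.
  case: (@split 1 n i) => {}i /=.
    rewrite col_mxEu mxE !(ord1 i) eqxx mulr1n -midpoint_frame_new.
    by congr (midpoint_frame p _ _ _); apply: val_inj.
  rewrite col_mxEd mxE -(midpoint_frame_old p).
  by congr (midpoint_frame p _ _ _); apply: val_inj.
have vp : v^T *m coord_col p k = (p a 0 k + p b 0 k)%:M.
  rewrite [LHS]mx11_scalar mxE; congr (_%:M).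
  under eq_bigr => j _ do rewrite !mxE mulrDl.
  by rewrite big_split /= !(sum_indicator _ (fun l => p l 0 k)).
have LTc : L^T *m (col_mx ((p a 0 k + p b 0 k) / 2)%:M (coord_col p k) : 'cV_(1 + n)) =
    col_mx 0 (coord_col p k).
  rewrite tr_block_mx mul_block_col !trmx1 trmx0 !mul1mx mul0mx add0r.
  rewrite linearZ /= -scalemxAl vp scale_scalar_mx -raddfD /=.
  have -> : (p a 0 k + p b 0 k) / 2 + - 2^-1 * (p a 0 k + p b 0 k) = 0 by field.
  by rewrite raddf0.
have Bc : block_mx (4 * w)%:M 0 0 (stress_block T E om la k) *m
    (col_mx 0 (coord_col p k) : 'cV_(1 + n)) = 0.
  by rewrite mul_block_col !mulmx0 mul0mx st !addr0 col_mx0.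
by rewrite -!mulmxA LTc Bc mulmx0.
Qed.

End OneExtension.

(** * Stresses of maximal rank that are nonzero on a prescribed edge *)

Lemma edge_stress_stress_vec (R : realType) n (E : {set {set 'I_n}})
    (om : {set 'I_n} -> R) la e :
  e \in E -> edge_stress (stress_vec E om la) e = om e.
Proof.
move=> eE; rewrite /edge_stress (big_pred1 (enum_rank_in eE e)) => [|k].
  by rewrite /stress_vec row_mxEl mxE enum_rankK_in.
by rewrite /= -(inj_eq enum_val_inj) enum_rankK_in.
Qed.

Lemma eq_stress_block (R : realType) T n (E : {set {set 'I_n}})
    (om om' : {set 'I_n} -> R) la la' k :
  {in E, om =1 om'} -> la =1 la' -> stress_block T E om la k = stress_block T E om' la' k.
Proof.
move=> eq_om eq_la.
have eq_w i j : stress_weight E om i j = stress_weight E om' i j.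
  by rewrite /stress_weight; case: ifP => // /eq_om.
apply/matrixP => i j; rewrite !mxE eq_la; congr (_ + _).
by case: ifP => _; rewrite ?eq_w //; apply: eq_bigr => l _.
Qed.

Lemma row_block_stress_vec (R : realType) T n (E : {set {set 'I_n}})
    (om : {set 'I_n} -> R) la k :
  row_block T (stress_vec E om la) k = stress_block T E om la k.
Proof.
apply: eq_stress_block => [e eE|i]; first exact: edge_stress_stress_vec.
by rewrite /vertex_stress /stress_vec row_mxEr mxE.
Qed.

Section RedundantEdge.
Variables (R : realType) (T : surface_type) (n : nat) (E : {set {set 'I_n}}).
Hypotheses (E_simple : simple_graph E) (T_proper : proper_surface T).
Variables (p : 'I_n -> 'rV[R]_3) (a b c : 'I_n).
Hypotheses (gp : generic_frame p) (nab : a != b) (nca : c != a) (ncb : c != b).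
Hypothesis abE : [set a; b] \in E.

(** If [w] vanishes on v_a v_b, it is a maximal stress of G - v_a v_b, which therefore has only
    trivial motions. The row of v_a v_b is then dependent on the others, and this gives a stress
    [w1] with value 1 there. Adding t [w1] to [w] keeps the ranks from dropping for all but finitely
    many t. *)
Lemma max_stress_edge_neq0 w :
  w *m rig_mx T E p = 0 ->
  (3 * n <= \sum_(k < 3) \rank (row_block T w k) + surface_mu T)%N ->
  exists w', [/\ w' *m rig_mx T E p = 0,
    (3 * n <= \sum_(k < 3) \rank (row_block T w' k) + surface_mu T)%N &
    edge_stress w' [set a; b] != 0].
Proof.
move=> wp w_max; have [w_ab|] := eqVneq (edge_stress w [set a; b]) 0; last by exists w.
pose H := E :\ [set a; b].
have H_simple : simple_graph H by move=> e /setD1P[_ /E_simple].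
have HE k : stress_block T H (edge_stress w) (vertex_stress w) k = row_block T w k.
  have eq_w i j : stress_weight H (edge_stress w) i j = stress_weight E (edge_stress w) i j.
    rewrite /stress_weight in_setD1; have [->|] //= := eqVneq [set i; j] [set a; b].
    by rewrite w_ab if_same.
  apply/matrixP => i j; rewrite !mxE; congr (_ + _).
  by case: ifP => _; rewrite ?eq_w //; apply: eq_bigr => l _.
have H_stress : stress_vec H (edge_stress w) (vertex_stress w) *m rig_mx T H p = 0.
  apply/(equilibriumP _ H_simple) => k; rewrite HE.
  by move: k; apply/(equilibriumP _ E_simple); rewrite stress_vecK.
have H_rigid u : motion T H p u -> trivial_motion T p u.
  apply: (generic_motion_trivial H_simple gp H_stress nab nca ncb) => //.
  by under eq_bigr => k _ do rewrite HE.
(* A row lies in the row space as soon as it annihilates the kernel; here the kernel consists of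
   trivial motions, which satisfy every edge equation. *)
have /submxP[y yE] : (edge_row p [set a; b] <= rig_mx T H p)%MS.
  rewrite submxE; apply/eqP/trmx_inj/row_matrixP => i; rewrite -!tr_col; congr trmx.
  rewrite colE -mulmxA -colE raddf0; set u := col i _.
  have Hu : rig_mx T H p *m u = 0 by rewrite /u colE mulmxA mulmx_coker mul0mx.
  have uE : u = (frame_vec (fun j => row j (vec_mx u^T)))^T.
    by rewrite frame_vec_surj trmxK.
  rewrite uE in Hu *; move/(motionP _ H_simple)/H_rigid: Hu.
  move=> /(@trivial_motion_is_motion _ _ _ E)[edge_u _].
  by rewrite [LHS]mx11_scalar edge_row_dot // edge_u // raddf0.
(* The coefficients of the relation (row of v_a v_b) - y R_H = 0. *)
pose om1 e : R := if e == [set a; b] then 1 else - edge_stress y e.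
pose w1 := stress_vec E om1 (fun i => - vertex_stress y i).
have w1_ab : edge_stress w1 [set a; b] = 1.
  by rewrite edge_stress_stress_vec // /om1 eqxx.
have w1p : w1 *m rig_mx T E p = 0.
  rewrite stress_vec_mul (big_setD1 _ abE) /= {1}/om1 eqxx scale1r yE.
  rewrite -{1}[y]stress_vecK stress_vec_mul.
  have -> : \sum_(e in E :\ [set a; b]) om1 e *: edge_row p e =
            - \sum_(e in H) edge_stress y e *: edge_row p e.
    rewrite -sumrN; apply: eq_bigr => e /setD1P[/negPf nab_e _].
    by rewrite /om1 nab_e scaleNr.
  rewrite [X in _ + X](_ : _ = - \sum_i vertex_stress y i *: vertex_row T p i).
    by rewrite addrAC addrK subrr.
  by rewrite -sumrN; apply: eq_bigr => i _; rewrite scaleNr.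
have PR := @poly_function_ring R.
pose F t := \prod_(k < 3) \det (mxsub (projT1 (exists_minor (row_block T w k)))
  (sval (projT2 (exists_minor (row_block T w k)))) (row_block T (w + t *: w1) k)).
have PF : poly_function F.
  apply: (fring_prod PR) => k _; apply: (fring_det PR).
  apply: (fring_mx_mxsub PR); apply: (fring_row_block PR) => i j.
  apply: (fring_ext PR) (fun t => w i j + t * w1 i j) _ _ _ => [t|].
    by rewrite !mxE.
  apply: (fring_add PR); first exact: poly_function_const.
  by apply: (fring_mul PR); [apply: poly_function_id | apply: poly_function_const].
have F0 : F 0 != 0.
  apply/prodf_neq0 => k _; rewrite scale0r addr0.
  exact: (svalP (projT2 (exists_minor (row_block T w k)))).
(* The successor keeps t nonzero, so that the new stress does not vanish on v_a v_b. *)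
have [|k Fk] := @poly_function_neq0 R F 0 (fun k => k.+1%:R) PF F0.
  by move=> i j /eqP; rewrite eqr_nat => /eqP[].
exists (w + k.+1%:R *: w1); split.
- by rewrite mulmxDl wp add0r -scalemxAl w1p scaler0.
- apply: leq_trans w_max _; rewrite leq_add2r; apply: leq_sum => l _.
  by have /prodf_neq0/(_ l isT)/minor_rank := Fk.
suff -> : edge_stress (w + k.+1%:R *: w1) [set a; b] =
    edge_stress w [set a; b] + k.+1%:R * edge_stress w1 [set a; b].
  by rewrite w_ab w1_ab add0r mulr1 pnatr_eq0.
rewrite /edge_stress mulr_sumr -big_split /=.
by apply: eq_bigr => l _; rewrite !mxE.
Qed.

End RedundantEdge.

(** * Transfer from p to q through the midpoint extension *)

Theorem theorem6p4 (R : realType) (alpha beta : rat)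
    (alpha_gt1 : 1 < alpha) (lt_alpha_beta : alpha < beta)
    (n : nat) (S : surface_family R n)
    (S_kind : kind S = Cylinders \/ kind S = Ellipsoids alpha beta)
    (E : {set {set 'I_n}}) (E_simple : simple_graph E)
    (p : 'I_n -> 'rV[R]_3) (p_on_S : framework_on S p)
    (p_rigid : infinitesimally_rigid S E p)
    (omega : {set 'I_n} -> R) (lambda : 'I_n -> R)
    (stress_eq : equilibrium_stress S E p omega lambda)
    (stress_rank : max_rank_stress S E omega lambda)
    (E' : {set {set 'I_n.+1}}) (E'_ext : one_extension E E')
    (q : 'I_n.+1 -> 'rV[R]_3) (q_generic : generic q) :
  let Sq := induced (kind S) q in
  [/\ framework_on Sq q,
      infinitesimally_rigid Sq E' q &
      exists (omega' : {set 'I_n.+1} -> R) (lambda' : 'I_n.+1 -> R),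
        equilibrium_stress Sq E' q omega' lambda' /\
        max_rank_stress Sq E' omega' lambda'].
Proof.
have [a [b [c [nab abE nca ncb E'E]]]] := E'_ext.
have gq := generic_is_generic_frame q_generic.
have gp1 := generic_frame_lift gq; set p1 := (fun i => _) in gp1.
set T := kind S in S_kind *.
have T_proper : proper_surface T.
  have alpha_gt0 := lt_trans ltr01 alpha_gt1.
  by case: S_kind => -> //=; rewrite alpha_gt0 (lt_trans alpha_gt0).
have T_coef k : 0 <= surface_coef R T k.
  case: T {S_kind} T_proper => [|al be] /= => [_|/andP[al0 be0]];
    by elim/ord3_ind: k; rewrite /= ?ler0q ?ler01 // ltW.
have T_cx : surface_coef R T cx = 1 by case: (T).
(* The parameters are positive: the x-coordinates are nonzero by genericity and the other terms are
   nonnegative. *)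
have q_on : framework_on (induced T q) q.
  move=> i; split=> //; rewrite /= /surface_form big_ord3 T_cx mul1r -addrA.
  rewrite ltr_pwDl ?exprn_even_gt0 ?(generic_coord gq) //.
  by rewrite addr_ge0 // mulr_ge0 // sqr_ge0.
have rank_E : (\rank (rig_mx T E p) + surface_ell T = 3 * n)%N by exact: p_rigid.
have st_p : stress_vec E omega lambda *m rig_mx T E p = 0 by exact: stress_eq.
have rank_st : (3 * n <= \sum_(k < 3)
    \rank (row_block T (stress_vec E omega lambda) k) + surface_mu T)%N.
  move: stress_rank; rewrite /max_rank_stress /stress_matrix rank_mxdiag => <-.
  by rewrite leq_add2r; apply: leq_sum => k _; rewrite row_block_stress_vec.
(* No rank at a generic framework exceeds 3n - l, which is the rank attained at [p]. *)
have rank_p1 : (\rank (rig_mx T E p1) <= \rank (rig_mx T E p))%N.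
  rewrite -(leq_add2r (surface_ell T)) rank_E.
  exact: (rig_mx_rank_le T E_simple (generic_coord gp1 a cx)).
have [_ [w1 [w1p w1_rank]]] := stress_transfer gp1 rank_p1 st_p.
have w1_max : (3 * n <= \sum_(k < 3) \rank (row_block T w1 k) + surface_mu T)%N.
  by apply: leq_trans rank_st _; rewrite leq_add2r; apply: leq_sum => k _.
have [w [wp w_max w_ab]] :=
  max_stress_edge_neq0 E_simple T_proper gp1 nab nca ncb abE w1p w1_max.
have w_stress : stress_vec E (edge_stress w) (vertex_stress w) *m rig_mx T E p1 = 0.
  by rewrite stress_vecK.
have p1_rigid u : motion T E p1 u -> trivial_motion T p1 u.
  exact: (generic_motion_trivial E_simple gp1 w_stress nab nca ncb w_max T_proper).
have E'_simple := extension_simple E_simple E'E.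
(* [p'] is special but rigid and has a stress of the required rank; it is the source of the second
   transfer. *)
pose p' := midpoint_frame a b p1.
have p'_rank : (3 * n.+1 <= \rank (rig_mx T E' p') + surface_ell T)%N.
  apply: (rig_mx_rank_ge E'_simple) => u.
  exact: (midpoint_motion_trivial nab nca ncb E'E gp1).
have st' := extension_equilibrium E_simple nab abE E'E w_stress.
have q_le := rig_mx_rank_le T E'_simple (generic_coord gq ord0 cx).
have rank_q : (\rank (rig_mx T E' q) <= \rank (rig_mx T E' p'))%N.
  by rewrite -(leq_add2r (surface_ell T)); apply: leq_trans p'_rank.
have [rank_qp [w' [w'q w'_rank]]] := stress_transfer gq rank_q st'.
split=> //.
  apply/eqP; rewrite /infinitesimally_rigid eqn_leq; apply/andP; split=> //.
  by rewrite -[rigidity_matrix _ _ _]/(rig_mx T E' q) rank_qp.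
exists (edge_stress w'), (vertex_stress w').
have w'_stress : stress_vec E' (edge_stress w') (vertex_stress w') *m rig_mx T E' q = 0.
  by rewrite stress_vecK.
split; first exact: w'_stress.
apply/eqP; rewrite eqn_leq /stress_matrix rank_mxdiag.
have nab' : lift ord0 a != lift ord0 b by rewrite (inj_eq (@lift_inj _ _)).
rewrite (stress_rank_le E'_simple gq w'_stress nab') /=.
suff : (3 * n.+1 <= \sum_(k < 3) \rank (row_block T w' k) + surface_mu T)%N by [].
(* Each of the three blocks gains one in rank, which matches 3(n + 1) = 3n + 3 with the same
   [surface_mu]. *)
apply: (@leq_trans (\sum_(k < 3) (\rank (row_block T w k)).+1 + surface_mu T)).
  by move: w_max; rewrite !big_ord3; lia.
rewrite leq_add2r; apply: leq_sum => k _; apply: leq_trans (w'_rank k).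
by rewrite row_block_stress_vec (extension_stress_rank T E_simple nab abE E'E).
Qed.
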